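(* Suppose that $\theta$ and $\delta$ are finite Blaschke products. If $\omega$ is an inner function satisfying one of the following: (i) $\omega$ is a finite Blaschke product; (ii) $\mathcal Z(\theta)\cup\mathcal Z(\delta)\subseteq\bigcup\bigl\{\mathcal R(\omega,z_0): z_0\text{ is a singularity of }\omega\bigr\}$, then $$\theta\text{ and }\delta\text{ are coprime}\iff\theta\circ\omega\text{ and }\delta\circ\omega\text{ are coprime}.$$
   Context: All functions are on the open unit disk $\mathbb D$, with boundary $\mathbb T$; $H^\infty$ is the set of bounded analytic functions on $\mathbb D$, and an inner function is a function in $H^\infty$ whose boundary values have modulus $1$ almost everywhere on $\mathbb T$. $\mathcal Z(\theta)$ is the set of zeros of $\theta$ in $\mathbb D$. Two inner functions are coprime if they have no nonconstant common inner divisor. A point $z_0\in\mathbb T$ is a singularity of an inner function $\omega$ if $\omega$ does not extend analytically from $\mathbb D$ to $z_0$. The range set of $f\in H^\infty$ at $z_0\in\mathbb T$ is $\mathcal R(f,z_0):=\bigcap_{r>0}f\bigl(\mathbb D\cap\{z:|z-z_0|<r\}\bigr)$. *)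

(* Defs.v *)
From HB Require Import structures.
From mathcomp Require Import all_boot all_order all_algebra.
From mathcomp Require Import all_classical all_reals all_analysis.
From mathcomp Require Import complex.

Set Implicit Arguments.
Unset Strict Implicit.
Unset Printing Implicit Defensive.

Import Order.TTheory GRing.Theory Num.Theory.
Import numFieldNormedType.Exports.

Local Open Scope classical_set_scope.
Local Open Scope complex_scope.
Local Open Scope ring_scope.

(* Functions on the disk are total functions R[i] -> R[i]; every definition
   below only looks at their values on the open unit disk.  The norm `|z| is
   valued in R[i], and radii are taken in R[i] as well (0 < r and `|z| < r
   force r to be real).  The topology and the normed module structure are found
   on the alias R[i]^o of R[i]. *)

Section Disk.
Context {R : realType}.
Implicit Types (f g phi psi : R[i] -> R[i]) (z c : R[i]).

Definition unit_disk : set R[i] := [set z | `|z| < 1].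

Definition unit_circle : set R[i] := [set z | `|z| = 1].

(* Derivability in the direction 1 over the field R[i] is complex
   differentiability. *)
Definition analytic_on (U : set R[i]) f : Prop :=
  forall z, U z -> derivable (f : R[i]^o -> R[i]^o) z 1.

Definition Hinfty f : Prop :=
  analytic_on unit_disk f /\
  exists M : R[i], forall z, unit_disk z -> `|f z| <= M.

Definition expi (t : R) : R[i] := cos t +i* sin t.

(* w is the radial limit of f at the boundary point z. *)
Definition boundary_value f z (w : R[i]) : Prop :=
  (fun r : R => f (r%:C * z) : R[i]^o) @ (1 : R)^'- --> (w : R[i]^o).

(* A property holds almost everywhere on the circle when it holds at expi t for
   Lebesgue-almost every t. *)
Definition inner f : Prop :=
  Hinfty f /\
  {ae (@lebesgue_measure R), forall t : R,
    exists2 w : R[i], boundary_value f (expi t) w & `|w| = 1}.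

Definition constant_on_disk f : Prop :=
  exists c, forall z, unit_disk z -> f z = c.

(* The empty product is allowed: unimodular constants are finite Blaschke
   products. *)
Definition finite_blaschke f : Prop :=
  exists (c : R[i]) (s : seq R[i]),
    [/\ `|c| = 1,
        (forall a, a \in s -> unit_disk a) &
        forall z, unit_disk z ->
          f z = c * \prod_(a <- s) ((z - a) / (1 - a^* * z))].

Definition zeros f : set R[i] := [set z | unit_disk z /\ f z = 0].

Definition inner_divisor phi f : Prop :=
  inner phi /\
  exists2 psi, Hinfty psi & forall z, unit_disk z -> f z = phi z * psi z.

Definition coprime_inner f g : Prop :=
  forall phi, inner_divisor phi f -> inner_divisor phi g ->
    constant_on_disk phi.

Definition extends_analytically_to f z0 : Prop :=
  exists (r : R[i]) (g : R[i] -> R[i]),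
    [/\ 0 < r,
        analytic_on (ball (z0 : R[i]^o) r) g &
        forall z, unit_disk z -> ball (z0 : R[i]^o) r z -> g z = f z].

Definition singularities f : set R[i] :=
  [set z0 | unit_circle z0 /\ ~ extends_analytically_to f z0].

Definition range_set f z0 : set R[i] :=
  \bigcap_(r in [set r : R[i] | 0 < r])
    (f @` (unit_disk `&` ball (z0 : R[i]^o) r)).

End Disk.

(* Main.v *)
Require Import Defs.
From mathcomp Require Import all_boot all_order all_algebra.
From mathcomp Require Import all_classical all_reals all_analysis.
From mathcomp Require Import complex ring lra.

(** Both pairs are governed by one criterion ([coprime_blaschke_comp]): two
    finite Blaschke products, composed with a nonconstant inner function [w],
    are coprime if and only if their zero lists are disjoint.  The theorem
    follows by applying it to [omega] and to the identity, since the zero lists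
    do not depend on [w].

    If both lists contain [a], the Blaschke factor of [a] composed with [w] is
    a nonconstant common inner divisor.  If the lists are disjoint, the
    numerators of the two products are coprime polynomials, and a Bezout
    relation evaluated at [w z] shows that a common inner divisor [phi] is
    invertible in H^oo.  Then both [phi] and its inverse are inner, so both are
    bounded by 1 on the disk, hence [phi] has modulus 1 everywhere and is
    constant by the maximum principle.

    Two facts on inner functions carry this argument: their modulus is at most
    1 on the disk ([inner_le1]), and it is strictly smaller unless they are
    constant ([inner_lt1]).  Both rest on Cauchy's formula on circles
    ([cauchy_formula]), which is obtained without any continuity of the
    derivative: the circle of radius [r] is contracted linearly to [z], and
    Goursat's bisection is run on the parameter rectangle of this contraction
    ([bisection_vanish], [homotopy_rect_vanish]).

    For [inner_le1], Cauchy's formula bounds [|f z| ^+ n] by a constant times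
    the mean of [|f| ^+ n] over a circle of radius close to 1; by dominated
    convergence the means tend to 1, so all powers of [|f z|] are bounded by
    the same constant.  For [inner_lt1], Cauchy's formula is symmetrized into
    Schwarz's formula, which recovers a function from its real part on a
    circle; it shows that a function whose real part is nonnegative and
    vanishes at one point is constant. *)

Set Implicit Arguments.
Unset Strict Implicit.
Unset Printing Implicit Defensive.
Import Order.TTheory GRing.Theory Num.Theory.
Import numFieldNormedType.Exports.
Local Open Scope classical_set_scope.
Local Open Scope complex_scope.
Local Open Scope ring_scope.

Local Notation normc := (@Normc.normc _).
Local Notation Re := (@complex.Re _).
Local Notation Im := (@complex.Im _).

(** * Modulus, topology and differentiability of complex functions *)
Section Norms.
Context {R : realType}.
Implicit Types z w : R[i].

Lemma normcR z : `|z| = (normc z)%:C.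
Proof. by []. Qed.

Lemma normc_ge0 z : 0 <= normc z.
Proof. by case: z => a b; exact: sqrtr_ge0. Qed.

Lemma le_normcB z w : normc (z - w) <= normc z + normc w.
Proof. by rewrite -[normc w]normcN le_normcD. Qed.

Lemma normcBC z w : normc (z - w) = normc (w - z).
Proof. by rewrite -normcN opprB. Qed.

Lemma normcX z n : normc (z ^+ n) = normc z ^+ n.
Proof.
elim: n => [|n ih]; first by rewrite !expr0 Normc.normc1.
by rewrite !exprS Normc.normcM ih.
Qed.

Lemma normc_real (x : R) : normc x%:C = `|x|.
Proof. by rewrite /Normc.normc /= expr0n addr0 sqrtr_sqr. Qed.

Lemma sqr_normcE z : normc z ^+ 2 = Re z ^+ 2 + Im z ^+ 2.
Proof. by case: z => a b; rewrite sqr_sqrtr // addr_ge0 ?sqr_ge0. Qed.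

Lemma normc_conj z : normc z^* = normc z.
Proof. by case: z => a b /=; rewrite sqrrN. Qed.

Lemma mul_conj z : z * z^* = (normc z ^+ 2)%:C.
Proof.
by rewrite -sqr_normc normcR rmorphXn.
Qed.

Lemma le_Re_normc z : `|Re z| <= normc z.
Proof. by have := normc_ge_Re z; rewrite normcR lecR. Qed.

Lemma le_Im_normc z : `|Im z| <= normc z.
Proof.
rewrite -(@ler_pXn2r _ 2) ?nnegrE ?normc_ge0 // sqr_normcE real_normK ?num_real //.
by rewrite lerDr sqr_ge0.
Qed.

Lemma le_normc_ReIm z : normc z <= `|Re z| + `|Im z|.
Proof.
rewrite -(@ler_pXn2r _ 2) ?nnegrE ?normc_ge0 ?addr_ge0 // sqr_normcE.
rewrite -[Re z ^+ 2]real_normK ?num_real // -[Im z ^+ 2]real_normK ?num_real //.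
rewrite sqrrD addrAC lerDl mulrn_wge0 // mulr_ge0 //.
Qed.

Lemma eq0_normcE z : (normc z == 0) = (z == 0).
Proof.
by apply/eqP/eqP => [/Normc.eq0_normc //|->]; rewrite Normc.normc0.
Qed.

Lemma normc_gt0 z : (0 < normc z) = (z != 0).
Proof. by rewrite lt_def normc_ge0 andbT eq0_normcE. Qed.

Lemma unit_diskE z : unit_disk z <-> normc z < 1.
Proof. by rewrite /unit_disk /= normcR -(ltcR _ 1). Qed.

Lemma normc_expi (t : R) : normc (expi t) = 1.
Proof. by rewrite /= cos2Dsin2 sqrtr1. Qed.

Lemma normc_i : normc 'i = 1 :> R.
Proof. by rewrite /= expr0n expr1n add0r sqrtr1. Qed.

Lemma normc_circle (r t : R) : 0 <= r -> normc (r%:C * expi t) = r.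
Proof.
by move=> r0; rewrite Normc.normcM normc_expi normc_real mulr1 ger0_norm.
Qed.

(** Radii in the normed field of complex numbers are complex; this turns the
    filter statements about its topology into estimates between reals. *)
Lemma nbhs_normc (P : set R[i]) z :
  nbhs (z : R[i]^o) P <->
  exists2 e : R, 0 < e & forall w, normc (w - z) < e -> P w.
Proof.
split=> [/nbhs_ballP[e /= e0 he]|[e e0 he]].
  move: e0 he; case: e => a b; rewrite ltcE /= => /andP[/eqP b0 a0] he.
  exists a => // w hw; apply: he.
  rewrite /ball /= normcR normcBC ltcE /= -b0 eqxx /=; exact: hw.
apply/nbhs_ballP; exists e%:C; first by rewrite /= ltcR.
move=> w; rewrite /ball /= normcR ltcR normcBC => hw; exact: he.
Qed.

Lemma continuous_Re z : {for z, continuous (@complex.Re R : R[i]^o -> R)}.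
Proof.
move=> /= P /nbhs_ballP[e /= e0 he]; apply/nbhs_normc; exists e => // w hw.
apply: he; rewrite /ball /= distrC -raddfB.
exact: le_lt_trans (le_Re_normc _) hw.
Qed.

Lemma continuous_Im z : {for z, continuous (@complex.Im R : R[i]^o -> R)}.
Proof.
move=> /= P /nbhs_ballP[e /= e0 he]; apply/nbhs_normc; exists e => // w hw.
apply: he; rewrite /ball /= distrC -raddfB.
exact: le_lt_trans (le_Im_normc _) hw.
Qed.

Lemma continuous_normc z : {for z, continuous (@Normc.normc R : R[i]^o -> R)}.
Proof.
move=> /= P /nbhs_ballP[e /= e0 he]; apply/nbhs_normc; exists e => // w hw.
apply: he; rewrite /ball /= distrC.
apply: le_lt_trans hw; rewrite ler_norml; apply/andP; split.
  rewrite lerNl opprB lerBlDr normcBC.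
  by apply: le_trans (le_normcD _ _); rewrite subrK.
rewrite lerBlDr.
by apply: le_trans (le_normcD _ _); rewrite subrK.
Qed.

Lemma continuous_real_complex (x : R) :
  {for x, continuous (fun r : R => r%:C : R[i]^o)}.
Proof.
move=> /= P /nbhs_normc[e e0 he]; apply/nbhs_ballP; exists e => // y.
by rewrite /ball /= => hy; apply: he; rewrite -rmorphB normc_real distrC.
Qed.

Lemma continuous_conj z : {for z, continuous (@conjc R : R[i]^o -> R[i]^o)}.
Proof.
move=> /= P /nbhs_normc[e e0 he]; apply/nbhs_normc; exists e => // w hw.
by apply: he; rewrite -rmorphB normc_conj.
Qed.

Lemma continuous_ReIm (T : topologicalType) (f : T -> R[i]) x :
  {for x, continuous (Re \o f)} -> {for x, continuous (Im \o f)} ->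
  {for x, continuous (f : T -> R[i]^o)}.
Proof.
move=> cr ci; rewrite /continuous_at.
have -> : f = fun y => (Re (f y))%:C + 'i * (Im (f y))%:C.
  by apply/funext => y; rewrite -complexE.
apply: (@cvgD _ (R[i]^o)); last apply: (@cvgM (R[i])); first last.
- exact: (continuous_comp ci (@continuous_real_complex _)).
- exact: cvg_cst.
- exact: (continuous_comp cr (@continuous_real_complex _)).
Qed.

Lemma continuous_expi (t : R) : {for t, continuous (@expi R : R -> R[i]^o)}.
Proof.
apply: continuous_ReIm; [exact: continuous_cos | exact: continuous_sin].
Qed.

Lemma derivable_continuous (f : R[i] -> R[i]) z :
  derivable (f : R[i]^o -> R[i]^o) z 1 ->
  {for z, continuous (f : R[i]^o -> R[i]^o)}.
Proof. by move/derivable1_diffP; exact: differentiable_continuous. Qed.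

(** The first-order expansion at [z], in the form needed to compare a function
    with its tangent map on small rectangles. *)
Lemma derivable_normcP (f : R[i] -> R[i]) z :
  derivable (f : R[i]^o -> R[i]^o) z 1 ->
  exists d : R[i], forall e : R, 0 < e -> exists2 r : R, 0 < r &
    forall w, normc (w - z) < r ->
      normc (f w - f z - d * (w - z)) <= e * normc (w - z).
Proof.
move=> /cvg_ex[/= d /cvgrPdist_lt hd]; exists d => e e0.
have : 0 < e%:C by rewrite ltcR.
move=> /hd /nbhs_normc[r r0 hr].
exists r => // w wz.
have [->|nwz] := eqVneq w z; first by rewrite !subrr mulr0 subr0 Normc.normc0 mulr0.
have nz : w - z != 0 by rewrite subr_eq0.
have := hr (w - z); rewrite subr0 => /(_ wz nz).
rewrite normcR ltcR => /ltW h.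
have -> : f w - f z - d * (w - z) =
    - ((d - (w - z)^-1 *: (f ((w - z) *: 1 + z) - f z)) * (w - z)).
  rewrite /GRing.scale /= mulr1 subrK; field.
  exact: nz.
by rewrite normcN Normc.normcM ler_wpM2r // normc_ge0.
Qed.

Lemma derivable_comp (f g : R[i] -> R[i]) z :
  derivable (f : R[i]^o -> R[i]^o) z 1 ->
  derivable (g : R[i]^o -> R[i]^o) (f z) 1 ->
  derivable (g \o f : R[i]^o -> R[i]^o) z 1.
Proof.
move=> /derivable1_diffP df /derivable1_diffP dg.
apply/(@derivable1_diffP R[i] R[i]^o).
exact: (@differentiable_comp R[i] R[i]^o R[i]^o R[i]^o f g z df dg).
Qed.

End Norms.

(** * Integrals of complex functions over segments *)
Section ComplexIntegral.
Context {R : realType}.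
Implicit Types (a b c : R) (f g : R -> R[i]) (h : R -> R).
Local Notation mu := (@lebesgue_measure R).

Definition cint a b f : R[i] :=
  (\int[mu]_(x in `[a, b]) Re (f x)) +i* (\int[mu]_(x in `[a, b]) Im (f x)).

(** Continuity is required in a neighbourhood of the endpoints, rather than on
    the segment alone: every integrand below is defined beyond the segment,
    and this form composes without subspace topologies. *)
Definition continuous_seg a b f :=
  forall x, a <= x <= b -> {for x, continuous (f : R -> R[i]^o)}.

Lemma integrable_seg a b h :
  (forall x, a <= x <= b -> {for x, continuous h}) ->
  mu.-integrable `[a, b] (EFin \o h).
Proof.
move=> ch; apply: continuous_compact_integrable; first exact: segment_compact.
by apply: continuous_in_subspaceT => x; rewrite inE /= in_itv /=; exact: ch.
Qed.

Lemma integrable_Re a b f : continuous_seg a b f ->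
  mu.-integrable `[a, b] (EFin \o (Re \o f)).
Proof.
move=> cf; apply: integrable_seg => x /cf cfx.
exact: (continuous_comp cfx (@continuous_Re _ _)).
Qed.

Lemma integrable_Im a b f : continuous_seg a b f ->
  mu.-integrable `[a, b] (EFin \o (Im \o f)).
Proof.
move=> cf; apply: integrable_seg => x /cf cfx.
exact: (continuous_comp cfx (@continuous_Im _ _)).
Qed.

Lemma Rintegral_seg_cst a b (k : R) : a <= b ->
  \int[mu]_(x in `[a, b]) k = k * (b - a).
Proof.
move=> ab; rewrite Rintegral_cst //= lebesgue_measure_itv /= lte_fin.
by move: ab; rewrite le_eqVlt => /predU1P[->|->]; rewrite ?ltxx ?subrr.
Qed.

Lemma eq_ReIm (z w : R[i]) : Re z = Re w -> Im z = Im w -> z = w.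
Proof. by case: z w => [? ?] [? ?] /= -> ->. Qed.

Lemma Re_mul (z w : R[i]) : Re (z * w) = Re z * Re w - Im z * Im w.
Proof. by case: z w => [? ?] [? ?]. Qed.

Lemma Im_mul (z w : R[i]) : Im (z * w) = Re z * Im w + Im z * Re w.
Proof. by case: z w => [? ?] [? ?]. Qed.

Lemma eq_cint a b f g : (forall x, a <= x <= b -> f x = g x) ->
  cint a b f = cint a b g.
Proof.
move=> fg; apply: eq_ReIm => /=; apply: eq_Rintegral => x;
  by rewrite inE /= in_itv /= => /fg ->.
Qed.

Lemma cintD a b f g : continuous_seg a b f -> continuous_seg a b g ->
  cint a b (fun x => f x + g x) = cint a b f + cint a b g.
Proof.
move=> cf cg; apply: eq_ReIm; rewrite raddfD /=.
  rewrite -RintegralD //; [|exact: integrable_Re..].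
  by apply: eq_Rintegral => x _; rewrite raddfD.
rewrite -RintegralD //; [|exact: integrable_Im..].
by apply: eq_Rintegral => x _; rewrite raddfD.
Qed.

Lemma continuous_segM a b f g : continuous_seg a b f -> continuous_seg a b g ->
  continuous_seg a b (fun x => f x * g x).
Proof. move=> cf cg x xab; apply: (@cvgM R[i]); [exact: cf|exact: cg]. Qed.

Lemma continuous_seg_cst a b (k : R[i]) : continuous_seg a b (fun=> k).
Proof. move=> x _; exact: cvg_cst. Qed.

Lemma Rintegral_lin a b (r s : R) h1 h2 :
  mu.-integrable `[a, b] (EFin \o h1) -> mu.-integrable `[a, b] (EFin \o h2) ->
  \int[mu]_(x in `[a, b]) (r * h1 x + s * h2 x) =
  r * \int[mu]_(x in `[a, b]) h1 x + s * \int[mu]_(x in `[a, b]) h2 x.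
Proof.
move=> i1 i2; rewrite RintegralD ?RintegralZl //.
- exact: (integrableZl _ r i1).
- exact: (integrableZl _ s i2).
Qed.

Lemma cintZ a b (k : R[i]) f : continuous_seg a b f ->
  cint a b (fun x => k * f x) = k * cint a b f.
Proof.
move=> cf.
have ir := integrable_Re cf; have ii := integrable_Im cf.
have e r s := Rintegral_lin r s ir ii.
apply: eq_ReIm.
  rewrite Re_mul /= -mulNr -e; apply: eq_Rintegral => x _.
  by rewrite Re_mul mulNr.
by rewrite Im_mul /= addrC -e; apply: eq_Rintegral => x _; rewrite Im_mul addrC.
Qed.

Lemma cintB a b f g : continuous_seg a b f -> continuous_seg a b g ->
  cint a b (fun x => f x - g x) = cint a b f - cint a b g.
Proof.
move=> cf cg.
have cNg : continuous_seg a b (fun x => -1 * g x).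
  exact: (continuous_segM (@continuous_seg_cst a b (-1)) cg).
rewrite -[- cint a b g]mulN1r -(cintZ (-1) cg) -(cintD cf cNg).
by apply: eq_cint => x _; rewrite mulN1r.
Qed.

Lemma cint_cst a b (k : R[i]) : a <= b -> cint a b (fun=> k) = k * (b - a)%:C.
Proof.
move=> ab; rewrite /cint !Rintegral_seg_cst //.
by apply: eq_ReIm; rewrite ?Re_mul ?Im_mul /= !mulr0 ?subr0 ?add0r.
Qed.

Lemma cint_conj a b f : continuous_seg a b f ->
  cint a b (fun x => (f x)^*) = (cint a b f)^*.
Proof.
move=> cf; apply: eq_ReIm => /=.
  by apply: eq_Rintegral => x _; case: (f x).
rewrite -mulN1r -RintegralZl //; last exact: integrable_Im.
by apply: eq_Rintegral => x _; case: (f x) => u v; rewrite mulN1r.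
Qed.

Lemma Rintegral_seg_split a b c h : a <= b -> b <= c ->
  (forall x, a <= x <= c -> {for x, continuous h}) ->
  \int[mu]_(x in `[a, c]) h x =
  \int[mu]_(x in `[a, b]) h x + \int[mu]_(x in `[b, c]) h x.
Proof.
move=> ab bc ch.
have ih := integrable_seg ch.
rewrite -[X in _ + X]Rintegral_itv_obnd_cbnd; last first.
  apply: (integrableS _ _ _ ih) => //; apply: subset_itv; rewrite bnd_simp ?lexx //.
rewrite -(@Rintegral_itvB _ h (BLeft a) (BRight c) b) ?bnd_simp //.
by rewrite addrC subrK.
Qed.

Lemma cint_split a b c f : a <= b -> b <= c -> continuous_seg a c f ->
  cint a c f = cint a b f + cint b c f.
Proof.
move=> ab bc cf; apply: eq_ReIm; rewrite raddfD /=; last first.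
  rewrite (@Rintegral_seg_split a b c (Im \o f)) // => x /cf cfx.
  exact: (continuous_comp cfx (@continuous_Im _ _)).
rewrite (@Rintegral_seg_split a b c (Re \o f)) // => x /cf cfx.
exact: (continuous_comp cfx (@continuous_Re _ _)).
Qed.

Lemma Rintegral_le a b h1 h2 :
  (forall x, a <= x <= b -> {for x, continuous h1}) ->
  (forall x, a <= x <= b -> {for x, continuous h2}) ->
  (forall x, a <= x <= b -> h1 x <= h2 x) ->
  \int[mu]_(x in `[a, b]) h1 x <= \int[mu]_(x in `[a, b]) h2 x.
Proof.
move=> c1 c2 h12; have i1 := integrable_seg c1; have i2 := integrable_seg c2.
exact: le_Rintegral i1 i2 _.
Qed.

(** The factor 2 comes from bounding real and imaginary parts separately; the
    sharp constant 1 would bring nothing, since the estimates are applied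
    either to quantities that tend to 0 or to all the powers of a function. *)
Lemma normc_cint_le_int a b f h : continuous_seg a b f ->
  (forall x, a <= x <= b -> {for x, continuous h}) ->
  (forall x, a <= x <= b -> normc (f x) <= h x) ->
  normc (cint a b f) <= 2 * \int[mu]_(x in `[a, b]) h x.
Proof.
move=> cf ch fh; apply: le_trans (le_normc_ReIm _) _; rewrite mulr2n mulrDl mul1r /=.
have ir := integrable_Re cf; have ii := integrable_Im cf.
have ih := integrable_seg ch.
apply: lerD.
  apply: le_trans (le_normr_Rintegral _ ir) _ => //.
  apply: le_Rintegral => //; first exact: (integrable_norm ir).
  move=> x /=; rewrite in_itv /= => /fh; exact: le_trans (le_Re_normc _).
apply: le_trans (le_normr_Rintegral _ ii) _ => //.
apply: le_Rintegral => //; first exact: (integrable_norm ii).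
move=> x /=; rewrite in_itv /= => /fh; exact: le_trans (le_Im_normc _).
Qed.

Lemma normc_cint_le a b f (M : R) : a <= b -> continuous_seg a b f ->
  (forall x, a <= x <= b -> normc (f x) <= M) ->
  normc (cint a b f) <= 2 * (M * (b - a)).
Proof.
move=> ab cf fM; rewrite -Rintegral_seg_cst //; apply: normc_cint_le_int => //.
move=> x _; exact: cvg_cst.
Qed.

Lemma cint_i_expi a b : a <= b -> cint a b (fun t => 'i * expi t) = expi b - expi a.
Proof.
rewrite le_eqVlt => /predU1P[->|ab].
  by rewrite /cint !set_itv1 !Rintegral_set1 subrr.
have cS : {within `[a, b], continuous (fun x : R => - sin x)}.
  by apply: continuous_subspaceT => x; apply: cvgN; exact: continuous_sin.
have cC : {within `[a, b], continuous (@cos R)}.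
  by apply: continuous_subspaceT => x; exact: continuous_cos.
have -> : cint a b (fun t => 'i * expi t) =
    (\int[mu]_(x in `[a, b]) (- sin x)) +i* (\int[mu]_(x in `[a, b]) cos x).
  by apply: eq_ReIm => /=; apply: eq_Rintegral => x _ /=;
    rewrite ?mul0r ?mul1r ?sub0r ?add0r.
rewrite /Rintegral (@continuous_FTC2 _ _ (@cos R)) //.
- rewrite (@continuous_FTC2 _ _ (@sin R)) //.
  + split; last 2 first.
    * apply: cvg_at_right_filter; exact: continuous_sin.
    * apply: cvg_at_left_filter; exact: continuous_sin.
    by move=> x _; exact: ex_derive.
  + by move=> x _; rewrite derive1E derive_val.
- split; last 2 first.
  + apply: cvg_at_right_filter; exact: continuous_cos.
  + apply: cvg_at_left_filter; exact: continuous_cos.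
  by move=> x _; exact: ex_derive.
- by move=> x _; rewrite derive1E derive_val.
Qed.

End ComplexIntegral.

(** * Goursat's bisection on rectangles *)
Section Bisection.
Context {R : realType}.

Lemma nested_point (x y : nat -> R) :
  (forall n, x n <= x n.+1) -> (forall n, y n.+1 <= y n) ->
  (forall n, x n <= y n) -> exists p, forall n, x n <= p <= y n.
Proof.
move=> xS yS xy.
have nx : {homo x : m n / (m <= n)%N >-> m <= n}.
  by apply: homo_leq => //; exact: le_trans.
have ny : {homo y : m n / (m <= n)%N >-> n <= m}.
  by apply: homo_leq => // ? ? ? h1 h2; exact: le_trans h2 h1.
have xyb m n : x m <= y n.
  apply: le_trans (nx _ _ (leq_maxl m n)) _.
  exact: le_trans (xy _) (ny _ _ (leq_maxr m n)).
exists (sup (range x)) => n; apply/andP; split.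
  by apply: ub_le_sup; [exists (y n) => _ [m _ <-]; exact: xyb | exists n].
by apply: sup_le_ub; [exists (x n), n | move=> _ [m _ <-]; exact: xyb].
Qed.

Variable I : R -> R -> R -> R -> R[i].
Variables a b c d : R.
Hypotheses (ab : a <= b) (cd : c <= d).

Let inside x y u v := [&& a <= x, x <= y & y <= b] && [&& c <= u, u <= v & v <= d].

Hypothesis split_fst : forall x y z u v, a <= x -> x <= y -> y <= z -> z <= b ->
  c <= u -> u <= v -> v <= d -> I x z u v = I x y u v + I y z u v.
Hypothesis split_snd : forall x y u v w, a <= x -> x <= y -> y <= b ->
  c <= u -> u <= v -> v <= w -> w <= d -> I x y u w = I x y u v + I x y v w.
Hypothesis local_bound : forall p q, a <= p <= b -> c <= q <= d ->
  forall e, 0 < e -> exists2 r, 0 < r & forall x y u v,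
    a <= x -> x <= p -> p <= y -> y <= b -> c <= u -> u <= q -> q <= v -> v <= d ->
    y - x < r -> v - u < r ->
    normc (I x y u v) <= e * ((y - x) + (v - u)) ^+ 2.

Lemma bisect_fst x y u v : inside x y u v -> exists x' y',
  [/\ x <= x', y' <= y, y' - x' = (y - x) / 2, inside x' y' u v &
      normc (I x y u v) <= 2 * normc (I x' y' u v)].
Proof.
move=> /andP[/and3P[ax xy yb] /and3P[cu uv vd]].
have xm : x <= (x + y) / 2 by lra.
have my : (x + y) / 2 <= y by lra.
have := split_fst ax xm my yb cu uv vd.
set m := (x + y) / 2 in xm my * => e.
have [h|h] := leP (normc (I x y u v)) (2 * normc (I x m u v)).
  exists x, m; split => //; first by rewrite /m; lra.
  by rewrite /inside ax xm cu uv vd (le_trans my yb).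
exists m, y; split => //; first by rewrite /m; lra.
  by rewrite /inside yb my cu uv vd (le_trans ax xm).
have := le_normcD (I x m u v) (I m y u v); rewrite -e => h'.
by lra.
Qed.

Lemma bisect_snd x y u v : inside x y u v -> exists u' v',
  [/\ u <= u', v' <= v, v' - u' = (v - u) / 2, inside x y u' v' &
      normc (I x y u v) <= 2 * normc (I x y u' v')].
Proof.
move=> /andP[/and3P[ax xy yb] /and3P[cu uv vd]].
have um : u <= (u + v) / 2 by lra.
have mv : (u + v) / 2 <= v by lra.
have := split_snd ax xy yb cu um mv vd.
set m := (u + v) / 2 in um mv * => e.
have [h|h] := leP (normc (I x y u v)) (2 * normc (I x y u m)).
  exists u, m; split => //; first by rewrite /m; lra.
  by rewrite /inside ax xy yb cu um (le_trans mv vd).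
exists m, v; split => //; first by rewrite /m; lra.
  by rewrite /inside ax xy yb mv vd (le_trans cu um).
have := le_normcD (I x y u m) (I x y m v); rewrite -e => h'.
by lra.
Qed.

(** A rectangle [x, y] * [u, v] as the tuple [(x, y, u, v)]. *)
Definition rect := (R * R * R * R)%type.
Let inR (Q : rect) := inside Q.1.1.1 Q.1.1.2 Q.1.2 Q.2.
Let IR (Q : rect) := I Q.1.1.1 Q.1.1.2 Q.1.2 Q.2.

Lemma bisect_rect (Q : rect) : exists Q' : rect, inR Q ->
  [/\ inR Q', Q.1.1.1 <= Q'.1.1.1 /\ Q'.1.1.2 <= Q.1.1.2,
      Q.1.2 <= Q'.1.2 /\ Q'.2 <= Q.2,
      Q'.1.1.2 - Q'.1.1.1 = (Q.1.1.2 - Q.1.1.1) / 2 /\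
      Q'.2 - Q'.1.2 = (Q.2 - Q.1.2) / 2 &
      normc (IR Q) <= 4 * normc (IR Q')].
Proof.
case: (boolP (inR Q)) => [iQ|_]; last by exists Q.
move: Q iQ => [[[x y] u] v] iQ.
have [x' [y' [xx yy e1 i1 n1]]] := bisect_fst iQ.
have [u' [v' [uu vv e2 i2 n2]]] := bisect_snd i1.
exists (x', y', u', v') => _; split => //=.
by rewrite /IR /= in n1 *; lra.
Qed.

(** Goursat's bisection: if a function of rectangles is additive under
    subdivision and is negligible compared with the area near each point, then
    halving repeatedly towards the quarter that carries most of its value
    contradicts the estimate at the limit point. *)
Lemma bisection_vanish : I a b c d = 0.
Proof.
have [step hstep] := choice bisect_rect.
pose Q n := iter n step (a, b, c, d) : rect.
have QS n : Q n.+1 = step (Q n) by [].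
have iQ n : inR (Q n).
  elim: n => [|n ih]; first by rewrite /inR /inside /= !lexx ab cd.
  by rewrite QS; have [] := hstep _ ih.
have [p hp] : exists p, forall n, (Q n).1.1.1 <= p <= (Q n).1.1.2.
  apply: nested_point => n; rewrite ?QS; last first.
    by have /andP[/and3P[]] := iQ n.
  - by have [_ []] := hstep _ (iQ n).
  - by have [_ []] := hstep _ (iQ n).
have [q hq] : exists q, forall n, (Q n).1.2 <= q <= (Q n).2.
  apply: nested_point => n; rewrite ?QS; last first.
    by have /andP[_ /and3P[]] := iQ n.
  - by have [_ _ []] := hstep _ (iQ n).
  - by have [_ _ []] := hstep _ (iQ n).
have wid n : (Q n).1.1.2 - (Q n).1.1.1 = (b - a) / 2 ^+ n /\
    (Q n).2 - (Q n).1.2 = (d - c) / 2 ^+ n.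
  elim: n => [|n [ih1 ih2]]; first by rewrite !expr0 !divr1.
  have [_ _ _ [-> ->] _] := hstep _ (iQ n).
  by rewrite ih1 ih2 exprSr invfM !mulrA.
have big n : normc (I a b c d) <= 4 ^+ n * normc (IR (Q n)).
  elim: n => [|n ih]; first by rewrite expr0 mul1r.
  apply: le_trans ih _; rewrite exprSr -mulrA ler_wpM2l ?exprn_ge0 //.
  by rewrite QS; have [] := hstep _ (iQ n).
apply: Normc.eq0_normc; apply/eqP; rewrite eq_le normc_ge0 andbT.
set L := (b - a) + (d - c).
have L0 : 0 <= L by rewrite addr_ge0 ?subr_ge0.
(* At depth [n] the factor [4 ^+ n] compensates the area of the rectangle. *)
have key e : 0 < e -> normc (I a b c d) <= e * L ^+ 2.
  move=> e0.
  have [|| r r0 hr] := local_bound (p := p) (q := q) _ _ e0.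
  - exact: hp 0%N.
  - exact: hq 0%N.
  pose n := Num.bound (L / r).
  have n2 : L / 2 ^+ n < r.
    rewrite ltr_pdivrMr ?exprn_gt0 // mulrC -ltr_pdivrMr //.
    exact: (@upper_nthrootP R).
  apply: le_trans (big n) _.
  have [w1 w2] := wid n.
  have /andP[p1 p2] := hp n; have /andP[q1 q2] := hq n.
  have /andP[/and3P[ax xy yb] /and3P[cu uv vd]] := iQ n.
  have p2n : 0 < (2 ^+ n)^-1 :> R by rewrite invr_gt0 exprn_gt0.
  have := hr _ _ _ _ ax p1 p2 yb cu q1 q2 vd.
  rewrite w1 w2 -mulrDl -/L => h.
  have le1 : (b - a) / 2 ^+ n <= L / 2 ^+ n.
    by rewrite ler_pM2r // /L lerDl subr_ge0.
  have le2 : (d - c) / 2 ^+ n <= L / 2 ^+ n.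
    by rewrite ler_pM2r // /L lerDr subr_ge0.
  have := h (le_lt_trans le1 n2) (le_lt_trans le2 n2).
  rewrite -/(IR (Q n)) => {}h.
  have : 4 ^+ n * normc (IR (Q n)) <= 4 ^+ n * (e * (L / 2 ^+ n) ^+ 2).
    by rewrite ler_wpM2l // exprn_ge0.
  suff -> : 4 ^+ n * (e * (L / 2 ^+ n) ^+ 2) = e * L ^+ 2 by [].
  have -> : 4 ^+ n = (2 ^+ n) ^+ 2 :> R.
    by rewrite -exprM mulnC exprM; congr (_ ^+ n); ring.
  field.
  by rewrite expf_neq0.
apply/ler_addgt0Pr => e e0; rewrite add0r.
have L1 : 0 < L ^+ 2 + 1 by rewrite ltr_wpDl // sqr_ge0.
apply: le_trans (key (e / (L ^+ 2 + 1)) _) _; first by rewrite divr_gt0.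
rewrite mulrAC ler_pdivrMr // ler_wpM2l ?ltW //.
by lra.
Qed.

End Bisection.

(** * Cauchy's formula on circles *)
Section CauchyFormula.
Context {R : realType}.
Implicit Types (f : R[i] -> R[i]) (z w : R[i]).

Lemma normc_expiB (s t : R) : s <= t -> normc (expi t - expi s) <= 2 * (t - s).
Proof.
move=> st; rewrite -cint_i_expi // -[t - s]mul1r; apply: normc_cint_le => //.
  apply: continuous_segM; first exact: continuous_seg_cst.
  by move=> x _; exact: continuous_expi.
by move=> x _; rewrite Normc.normcM normc_expi mulr1 normc_i.
Qed.

Lemma normc_expiB_abs (s t : R) : normc (expi t - expi s) <= 2 * `|t - s|.
Proof.
have [st|/ltW ts] := leP s t.
  by rewrite ger0_norm ?subr_ge0 //; exact: normc_expiB.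
by rewrite distrC ger0_norm ?subr_ge0 // normcBC; exact: normc_expiB.
Qed.

Lemma expi2pi : expi (2 * pi) = expi 0 :> R[i].
Proof. by rewrite /expi -[2 * pi]add0r mulr_natl cosD2pi sinD2pi. Qed.

(** With [w = r%:C * expi t], the form [dw / (w - z)] is ['i] times this kernel
    times [dt]. *)
Definition cauchy_kernel (r : R) z (t : R) : R[i] :=
  r%:C * expi t / (r%:C * expi t - z).

Section Kernel.
Variables (r : R) (z : R[i]).
Hypotheses (r0 : 0 < r) (zr : normc z < r).

Lemma circle_sub_ge (t : R) : r - normc z <= normc (r%:C * expi t - z).
Proof.
rewrite lerBlDr -[leLHS](normc_circle t (ltW r0)) -{1}[r%:C * _](subrK z).
exact: le_normcD.
Qed.

Lemma circle_sub_neq0 (t : R) : r%:C * expi t - z != 0.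
Proof.
by rewrite -normc_gt0 (lt_le_trans _ (circle_sub_ge t)) // subr_gt0.
Qed.

Lemma normc_kernel_le (t : R) :
  normc (cauchy_kernel r z t) <= r / (r - normc z).
Proof.
rewrite Normc.normcM (normc_circle _ (ltW r0)) Normc.normcV.
rewrite (ler_wpM2l (ltW r0)) // lef_pV2 ?posrE ?subr_gt0 //.
  exact: circle_sub_ge.
by rewrite normc_gt0 circle_sub_neq0.
Qed.

Lemma continuous_circle_sub (t : R) :
  {for t, continuous (fun t : R => r%:C * expi t - z : R[i]^o)}.
Proof.
apply: (@cvgB _ (R[i]^o)); last exact: cvg_cst.
by apply: (@cvgM R[i]); [exact: cvg_cst | exact: continuous_expi].
Qed.

Lemma continuous_kernel (t : R) :
  {for t, continuous (cauchy_kernel r z : R -> R[i]^o)}.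
Proof.
apply: (@cvgM R[i]).
  by apply: (@cvgM R[i]); [exact: cvg_cst | exact: continuous_expi].
by apply: (@cvgV R[i]); [exact: circle_sub_neq0 | exact: continuous_circle_sub].
Qed.

End Kernel.

(** [W s t] contracts the circle of radius [r] to [z] as [s] decreases from 1
    to 0.  Along [w = W s t] the form [f w dw / (w - z)] equals
    [F s t (ds / s + k t dt)], and [I x y u v] is its integral around the
    boundary of the rectangle of the parameters [s] in [x, y], [t] in [u, v]. *)
Section Homotopy.
Variables (f : R[i] -> R[i]) (r : R) (z : R[i]).
Hypothesis r0 : 0 < r.
Hypothesis zr : normc z < r.
Hypothesis df : forall w, normc w <= r -> derivable (f : R[i]^o -> R[i]^o) w 1.

Let g (t : R) : R[i] := r%:C * expi t - z.
Let W (s t : R) : R[i] := z + s%:C * g t.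
Let F (s t : R) : R[i] := f (W s t).
Let k (t : R) : R[i] := 'i * cauchy_kernel r z t.
Let C : R := 2 * r + normc z.

Let normc_g_le t : normc (g t) <= C.
Proof.
apply: le_trans (le_normcB _ _) _.
by rewrite (normc_circle _ (ltW r0)) /C; have := r0; lra.
Qed.

Let gk t : g t * k t = r%:C * ('i * expi t).
Proof.
rewrite /k /cauchy_kernel -/(g t); field.
exact: circle_sub_neq0.
Qed.

Let normc_k t : normc (k t) <= r / (r - normc z).
Proof. by rewrite Normc.normcM normc_i mul1r; exact: normc_kernel_le. Qed.

Let continuous_g t : {for t, continuous (g : R -> R[i]^o)}.
Proof. exact: continuous_circle_sub. Qed.

Let continuous_k t : {for t, continuous (k : R -> R[i]^o)}.
Proof.
by apply: (@cvgM R[i]); [exact: cvg_cst | exact: continuous_kernel].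
Qed.

Let W_in s t : 0 <= s -> s <= 1 -> normc (W s t) <= r.
Proof.
move=> s0 s1.
have -> : W s t = (1 - s)%:C * z + s%:C * (r%:C * expi t).
  by rewrite /W /g rmorphB rmorph1; ring.
apply: le_trans (le_normcD _ _) _.
rewrite (Normc.normcM _ z) (Normc.normcM _ (_ * _)) (normc_circle _ (ltW r0)).
rewrite !normc_real.
rewrite !ger0_norm ?subr_ge0 //.
have : (1 - s) * normc z <= (1 - s) * r by rewrite ler_wpM2l ?subr_ge0 // ltW.
lra.
Qed.

Let continuous_F_fst s t : 0 <= s -> s <= 1 ->
  {for s, continuous (F ^~ t : R -> R[i]^o)}.
Proof.
move=> s0 s1; apply: (@continuous_comp R R[i]^o R[i]^o (W ^~ t) f).
  apply: (@cvgD _ (R[i]^o)); first exact: cvg_cst.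
  apply: (@cvgM R[i]); last exact: cvg_cst.
  exact: continuous_real_complex.
by apply: derivable_continuous; apply: df; exact: W_in.
Qed.

Let continuous_F_snd s t : 0 <= s -> s <= 1 ->
  {for t, continuous (F s : R -> R[i]^o)}.
Proof.
move=> s0 s1; apply: (@continuous_comp R R[i]^o R[i]^o (W s) f).
  apply: (@cvgD _ (R[i]^o)); first exact: cvg_cst.
  apply: (@cvgM R[i]); first exact: cvg_cst.
  exact: continuous_g.
by apply: derivable_continuous; apply: df; exact: W_in.
Qed.

Let I (x y u v : R) : R[i] :=
  cint u v (fun t => (F y t - F x t) * k t) -
  cint x y (fun s => (F s v - F s u) * (s%:C)^-1).

Section Truncated.
Variable a : R.
Hypotheses (a0 : 0 < a) (a1 : a <= 1).

Let seg_snd x y u v : a <= x -> x <= y -> y <= 1 ->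
  continuous_seg u v (fun t => (F y t - F x t) * k t).
Proof.
have A0 := a0; have A1 := a1; have R0 := r0.
move=> ax xy y1 t _; apply: (@cvgM R[i]); last exact: continuous_k.
have x0 : 0 <= x by lra.
by apply: (@cvgB _ (R[i]^o)); apply: continuous_F_snd => //; lra.
Qed.

Let continuous_inv (s : R) : a <= s ->
  {for s, continuous (fun s' : R => (s'%:C)^-1 : R[i]^o)}.
Proof.
have A0 := a0; have A1 := a1; have R0 := r0.
move=> s0; apply: (@cvgV R[i]); last exact: continuous_real_complex.
by rewrite -normc_gt0 normc_real normr_gt0; lra.
Qed.

Let seg_fst x y u v : a <= x -> y <= 1 ->
  continuous_seg x y (fun s => (F s v - F s u) * (s%:C)^-1).
Proof.
have A0 := a0; have A1 := a1; have R0 := r0.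
move=> ax y1 s /andP[xs sy].
apply: (@cvgM R[i]); last by apply: continuous_inv; lra.
by apply: (@cvgB _ (R[i]^o)); apply: continuous_F_fst; lra.
Qed.

(** Constants and multiples of [W] integrate to 0 around a rectangle, so the
    integral of [F] is that of its difference with any affine function of [W]. *)
Let local x y u v p q (d : R[i]) (e : R) : 0 <= e ->
  a <= x -> x <= p -> p <= y -> y <= 1 -> u <= q -> q <= v ->
  (forall s t, x <= s <= y -> u <= t <= v ->
    normc (F s t - F p q - d * (W s t - W p q)) <= e) ->
  normc (I x y u v) <=
    4 * e * (r / (r - normc z) * (v - u) + a^-1 * (y - x)).
Proof.
have A0 := a0; have A1 := a1; have R0 := r0.
move=> e0 ax xp py y1 uq qv hG.
have xy : x <= y by lra.
have uv : u <= v by lra.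
pose G s t := F s t - F p q - d * (W s t - W p q).
have cG1 : continuous_seg u v (fun t => (G y t - G x t) * k t).
  move=> t _; apply: (@cvgM R[i]); last exact: continuous_k.
  have cG s : 0 <= s -> s <= 1 -> {for t, continuous (G s : R -> R[i]^o)}.
    move=> s0 s1; apply: (@cvgB _ (R[i]^o)).
      apply: (@cvgB _ (R[i]^o)); last exact: cvg_cst.
      exact: continuous_F_snd.
    apply: (@cvgM R[i]); first exact: cvg_cst.
    apply: (@cvgB _ (R[i]^o)); last exact: cvg_cst.
    apply: (@cvgD _ (R[i]^o)); first exact: cvg_cst.
    by apply: (@cvgM R[i]); [exact: cvg_cst | exact: continuous_g].
  by apply: (@cvgB _ (R[i]^o)); apply: cG; lra.
have cie : continuous_seg u v (fun t => 'i * expi t).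
  apply: continuous_segM; first exact: continuous_seg_cst.
  by move=> t _; exact: continuous_expi.
have e1 : cint u v (fun t => (F y t - F x t) * k t) =
    cint u v (fun t => (G y t - G x t) * k t) +
    d * (y - x)%:C * r%:C * (expi v - expi u).
  rewrite -(cint_i_expi uv) -(cintZ _ cie) -(cintD cG1); last first.
    exact: (continuous_segM (@continuous_seg_cst _ u v _) cie).
  by apply: eq_cint => t _; rewrite -!mulrA -gk /G /W rmorphB /=; ring.
have cG2 t : continuous_seg x y (G ^~ t).
  move=> s /andP[xs sy]; apply: (@cvgB _ (R[i]^o)).
    apply: (@cvgB _ (R[i]^o)); last exact: cvg_cst.
    by apply: continuous_F_fst; lra.
  apply: (@cvgM R[i]); first exact: cvg_cst.
  apply: (@cvgB _ (R[i]^o)); last exact: cvg_cst.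
  apply: (@cvgD _ (R[i]^o)); first exact: cvg_cst.
  by apply: (@cvgM R[i]); [exact: continuous_real_complex | exact: cvg_cst].
have cGG : continuous_seg x y (fun s => (G s v - G s u) * (s%:C)^-1).
  move=> s xsy; apply: (@cvgM R[i]); last by apply: continuous_inv; lra.
  by apply: (@cvgB _ (R[i]^o)); exact: cG2.
have e2 : cint x y (fun s => (F s v - F s u) * (s%:C)^-1) =
    cint x y (fun s => (G s v - G s u) * (s%:C)^-1) +
    d * (y - x)%:C * r%:C * (expi v - expi u).
  have -> : d * (y - x)%:C * r%:C * (expi v - expi u) =
      d * r%:C * (expi v - expi u) * (y - x)%:C by ring.
  rewrite -(cint_cst (d * r%:C * (expi v - expi u)) xy).
  rewrite -(cintD cGG (@continuous_seg_cst _ x y _)).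
  apply: eq_cint => s /andP[xs sy].
  have s0 : s%:C != 0 :> R[i] by rewrite -normc_gt0 normc_real normr_gt0; lra.
  by rewrite /G /W /g; field.
have -> : I x y u v = cint u v (fun t => (G y t - G x t) * k t) -
    cint x y (fun s => (G s v - G s u) * (s%:C)^-1).
  by rewrite /I e1 e2; ring.
have GB s t s' t' : x <= s <= y -> x <= s' <= y -> u <= t <= v -> u <= t' <= v ->
    normc (G s t - G s' t') <= 2 * e.
  move=> h1 h2 h3 h4; apply: le_trans (le_normcB _ _) _.
  by have := hG s t h1 h3; have := hG s' t' h2 h4; rewrite /G; lra.
apply: le_trans (le_normcB _ _) _.
have b1 : normc (cint u v (fun t => (G y t - G x t) * k t)) <=
    2 * ((2 * e * (r / (r - normc z))) * (v - u)).
  apply: (normc_cint_le uv cG1) => t htv; rewrite Normc.normcM.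
  by apply: ler_pM; rewrite ?normc_ge0 ?normc_k //; apply: GB; lra.
have b2 : normc (cint x y (fun s => (G s v - G s u) * (s%:C)^-1)) <=
    2 * ((2 * e * a^-1) * (y - x)).
  apply: (normc_cint_le xy cGG) => s xsy; rewrite Normc.normcM.
  apply: ler_pM; rewrite ?normc_ge0 //; first by apply: GB; lra.
  rewrite Normc.normcV normc_real lef_pV2 ?posrE ?normr_gt0 ?ger0_norm; lra.
lra.
Qed.

(** Near a point, [F] differs from its tangent map by little compared with the
    size of the rectangle, and so does the integral compared with the square
    of that size: the bisection lemma applies.  The lower bound [a] on the
    radius parameter keeps [ds / s] bounded. *)
Lemma homotopy_rect_vanish u v : u <= v -> I a 1 u v = 0.
Proof.
have A0 := a0; have A1 := a1; have R0 := r0.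
move=> uv; apply: (bisection_vanish a1 uv).
- move=> x y x' u' v' ax xy yx' x'1 _ _ _; rewrite /I.
  rewrite (cint_split xy yx' (@seg_fst x x' u' v' ax x'1)).
  have -> : cint u' v' (fun t => (F x' t - F x t) * k t) =
      cint u' v' (fun t => (F y t - F x t) * k t) +
      cint u' v' (fun t => (F x' t - F y t) * k t).
    have c1 : continuous_seg u' v' (fun t => (F y t - F x t) * k t).
      by apply: seg_snd; lra.
    have c2 : continuous_seg u' v' (fun t => (F x' t - F y t) * k t).
      by apply: seg_snd; lra.
    rewrite -(cintD c1 c2).
    by apply: eq_cint => t _; ring.
  by ring.
- move=> x y u' v' w' ax xy y1 _ uv' vw' _; rewrite /I.
  rewrite (cint_split uv' vw' (@seg_snd x y u' w' ax xy y1)).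
  have -> : cint x y (fun s => (F s w' - F s u') * (s%:C)^-1) =
      cint x y (fun s => (F s v' - F s u') * (s%:C)^-1) +
      cint x y (fun s => (F s w' - F s v') * (s%:C)^-1).
    rewrite -cintD; [|exact: seg_fst..].
    by apply: eq_cint => t _; ring.
  by ring.
move=> p q /andP[ap p1] _ e e0.
have C0 : 0 < C by have := normc_ge0 z; rewrite /C; lra.
set K := r / (r - normc z).
have K0 : 0 < K by rewrite divr_gt0 // subr_gt0.
have ai : 0 < a^-1 by rewrite invr_gt0.
(* Dividing [e] by [D] makes the bound of [local] add up to [e * L ^+ 2]. *)
pose D := 4 * C * (K + a^-1).
have D0 : 0 < D by rewrite !mulr_gt0 // addr_gt0.
have [|d hd] := derivable_normcP (df (w := W p q) _).
  by apply: W_in; lra.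
have [r1 r10 hr1] := hd (e / D) (divr_gt0 e0 D0).
(* On rectangles with sides below this, [W] stays within [r1] of [W p q]. *)
exists (r1 / (2 * C)); first by rewrite divr_gt0 // mulr_gt0.
move=> x y u' v' ax xp py y1 _ uq qv _.
rewrite !ltr_pdivlMr ?mulr_gt0 // => h1 h2.
set L := (y - x) + (v' - u').
have L0 : 0 <= L by rewrite /L; lra.
have WB s t : x <= s <= y -> u' <= t <= v' -> normc (W s t - W p q) <= C * L.
  move=> hs ht.
  have -> : W s t - W p q = (s - p)%:C * g t + p%:C * (r%:C * (expi t - expi q)).
    by rewrite /W /g rmorphB; ring.
  apply: le_trans (le_normcD _ _) _; rewrite !Normc.normcM !normc_real.
  have n1 : `|s - p| <= y - x by rewrite ler_norml; lra.
  have n2 : `|t - q| <= v' - u' by rewrite ler_norml; lra.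
  have n3 := normc_expiB_abs q t.
  have n4 := normc_g_le t.
  have m1 : `|s - p| * normc (g t) <= (y - x) * C by rewrite ler_pM ?normc_ge0.
  have m2 : `|p| * (`|r| * normc (expi t - expi q)) <= 1 * (r * (2 * (v' - u'))).
    apply: ler_pM; rewrite ?mulr_ge0 ?normc_ge0 //; first by rewrite ler_norml; lra.
    rewrite (gtr0_norm R0); apply: (ler_wpM2l (ltW R0)).
    by apply: le_trans n3 _; rewrite ler_wpM2l.
  have m3 : 0 <= normc z * (v' - u') by rewrite mulr_ge0 ?normc_ge0 //; lra.
  rewrite /C /L in m1 *; lra.
have CL : C * L < r1 by rewrite /L; lra.
have E0 : 0 <= e / D * (C * L).
  apply: mulr_ge0; apply: mulr_ge0 => //; first exact: ltW.
    by rewrite invr_ge0 ltW.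
  exact: ltW.
apply: le_trans (@local x y u' v' p q d (e / D * (C * L)) _ _ _ _ _ _ _ _) _ => //.
- move=> s t hs ht; have wb := WB s t hs ht.
  apply: le_trans (hr1 _ (le_lt_trans wb CL)) _.
  by rewrite ler_wpM2l // ltW // divr_gt0.
rewrite -/K.
have -> : e * L ^+ 2 = 4 * (e / D * (C * L)) * ((K + a^-1) * L).
  have -> : 4 * (e / D * (C * L)) * ((K + a^-1) * L) = e / D * D * L ^+ 2.
    by rewrite {3}/D; ring.
  by rewrite divfK ?gt_eqF.
rewrite ler_wpM2l //; first by rewrite mulr_ge0.
have q1 : 0 <= K * (y - x) by apply: mulr_ge0; [exact: ltW | lra].
have q2 : 0 <= a^-1 * (v' - u') by apply: mulr_ge0; [exact: ltW | lra].
by rewrite /L; lra.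
Qed.

End Truncated.

Let pi2_ge0 : 0 <= 2 * pi :> R.
Proof. by rewrite mulr_ge0 // pi_ge0. Qed.

(** The two sides of the rectangle on which the angle is 0 and 2 pi cancel, so
    the integral over the circles [W s] does not depend on [s]; it tends to the
    right-hand side as [s] tends to 0. *)
Lemma homotopy_integral :
  cint 0 (2 * pi) (fun t => f (r%:C * expi t) * cauchy_kernel r z t) =
  f z * cint 0 (2 * pi) (cauchy_kernel r z).
Proof.
have R0 := r0.
have C0 : 0 < C by have := normc_ge0 z; rewrite /C; lra.
have K0 : 0 <= r / (r - normc z) by rewrite divr_ge0 ?ltW // subr_gt0.
have segF s : 0 <= s -> s <= 1 ->
    continuous_seg 0 (2 * pi) (fun t => F s t * k t).
  move=> s0 s1 t _; apply: (@cvgM R[i]); last exact: continuous_k.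
  exact: continuous_F_snd.
have segk : continuous_seg 0 (2 * pi) k by move=> t _; exact: continuous_k.
have F1 t : F 1 t = f (r%:C * expi t).
  by rewrite /F /W /g rmorph1 mul1r addrC subrK.
have const a : 0 < a -> a <= 1 ->
    cint 0 (2 * pi) (fun t => F 1 t * k t) = cint 0 (2 * pi) (fun t => F a t * k t).
  move=> a0 a1; apply/eqP; rewrite -subr_eq0; apply/eqP.
  rewrite -(homotopy_rect_vanish a0 a1 pi2_ge0) /I.
  rewrite -(cintB (segF 1 ler01 (lexx _)) (segF a (ltW a0) a1)).
  rewrite [X in _ = _ - X](_ : _ = 0).
    by rewrite subr0; apply: eq_cint => t _; rewrite mulrBl.
  rewrite (@eq_cint _ _ _ _ (fun=> 0)) ?cint_cst ?mul0r // => s _.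
  by rewrite /F /W /g expi2pi subrr mul0r.
have main : cint 0 (2 * pi) (fun t => F 1 t * k t) = f z * cint 0 (2 * pi) k.
  apply/eqP; rewrite -subr_eq0 -eq0_normcE eq_le normc_ge0 andbT.
  apply/ler_addgt0Pr => e e0; rewrite add0r.
  pose B := 2 * (r / (r - normc z) * (2 * pi)) + 1.
  have B0 : 0 < B by apply: ltr_wpDl => //; apply: mulr_ge0 => //; exact: mulr_ge0.
  have := derivable_continuous (df (ltW zr)).
  have eB : 0 < e / B by rewrite divr_gt0.
  move=> /(_ [set w | normc (w - f z) < e / B]) /=.
  have nb : nbhs (f z : R[i]^o) [set w | normc (w - f z) < e / B].
    by apply/nbhs_normc; exists (e / B).
  move=> /(_ nb) /nbhs_normc[h h0 hh].
  pose a := Num.min 1 (h / (2 * C)).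
  have a0 : 0 < a by rewrite lt_min ltr01 divr_gt0 // mulr_gt0.
  have a1 : a <= 1 by rewrite ge_min lexx.
  have aC : a * C < h.
    have : a <= h / (2 * C) by rewrite ge_min lexx orbT.
    rewrite ler_pdivlMr ?mulr_gt0 //; lra.
  have segk' : continuous_seg 0 (2 * pi) (fun t => f z * k t).
    exact: (continuous_segM (@continuous_seg_cst _ 0 (2 * pi) (f z)) segk).
  rewrite (const a a0 a1) -(cintZ _ segk) -(cintB (segF a (ltW a0) a1) segk').
  apply: le_trans (@normc_cint_le _ _ _ _ (e / B * (r / (r - normc z))) pi2_ge0 _ _) _.
  - move=> t ht; apply: (@cvgB _ (R[i]^o)); [exact: (segF a (ltW a0) a1) | exact: segk'].
  - move=> t _; rewrite -mulrBl Normc.normcM; apply: ler_pM; rewrite ?normc_ge0 //.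
    apply: ltW; apply: (hh (W a t)); rewrite /W addrC addKr.
    rewrite Normc.normcM normc_real gtr0_norm //; apply: le_lt_trans aC.
    by rewrite ler_wpM2l // ltW.
  rewrite subr0; have -> : 2 * (e / B * (r / (r - normc z)) * (2 * pi)) = e / B * (B - 1).
    by rewrite {3}/B; ring.
  have : e / B * (B - 1) <= e / B * B by rewrite ler_wpM2l ?ltW //; lra.
  by rewrite divfK // gt_eqF.
have segKer : continuous_seg 0 (2 * pi) (cauchy_kernel r z).
  by move=> t _; exact: continuous_kernel.
have segFK : continuous_seg 0 (2 * pi)
    (fun t => f (r%:C * expi t) * cauchy_kernel r z t).
  move=> t _; apply: (@cvgM R[i]); last exact: continuous_kernel.
  have := @continuous_F_snd 1 t ler01 (lexx _).
  by rewrite (_ : F 1 = fun t => f (r%:C * expi t)) //; apply/funext => t'.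
have i0 : 'i != 0 :> R[i] by rewrite -eq0_normcE normc_i oner_eq0.
apply: (mulfI i0); rewrite mulrCA -(cintZ _ segKer) -(cintZ _ segFK) -main.
by apply: eq_cint => t _; rewrite F1 /k mulrCA.
Qed.

End Homotopy.

Lemma cauchy_kernel0 (r t : R) : 0 < r -> cauchy_kernel r 0 t = 1.
Proof.
move=> r0; rewrite /cauchy_kernel subr0 divff // -normc_gt0 normc_circle //.
exact: ltW.
Qed.

Lemma continuous_circle f (r : R) : 0 <= r ->
  (forall w, normc w <= r -> derivable (f : R[i]^o -> R[i]^o) w 1) ->
  forall t : R, {for t, continuous (fun t : R => f (r%:C * expi t) : R[i]^o)}.
Proof.
move=> r0 df t; apply: (@continuous_comp R R[i]^o R[i]^o (fun t : R => r%:C * expi t) f).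
  by apply: (@cvgM R[i]); [exact: cvg_cst | exact: continuous_expi].
apply: derivable_continuous; apply: df.
by rewrite normc_circle.
Qed.

Lemma mean_value f (r : R) : 0 < r ->
  (forall w, normc w <= r -> derivable (f : R[i]^o -> R[i]^o) w 1) ->
  cint 0 (2 * pi) (fun t => f (r%:C * expi t)) = (2 * pi)%:C * f 0.
Proof.
move=> r0 df; have pi2 : 0 <= 2 * pi :> R by rewrite mulr_ge0 // pi_ge0.
have zr : normc 0 < r by rewrite Normc.normc0.
have := homotopy_integral r0 zr df.
rewrite [in RHS](@eq_cint _ _ _ _ (fun=> 1)); last by move=> t _; exact: cauchy_kernel0.
rewrite cint_cst // subr0 mul1r [f 0 * _]mulrC => <-.
by apply: eq_cint => t _; rewrite cauchy_kernel0 // mulr1.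
Qed.

Lemma conj_real (x : R) : (x%:C : R[i])^* = x%:C.
Proof. exact: conjc_real. Qed.

(** On the circle, [w^* = r ^+ 2 / w], so the Cauchy kernel is the conjugate of
    a function analytic in a neighbourhood of the closed disk. *)
Lemma conj_kernelE (r : R) z (t : R) : 0 < r -> normc z < r ->
  cauchy_kernel r z t = ((1 - z^* * (r%:C * expi t) / (r ^+ 2)%:C)^-1)^*.
Proof.
move=> r0 zr; set w := r%:C * expi t.
have nw : normc w = r by exact: (normc_circle _ (ltW r0)).
have w0 : w != 0 by rewrite -normc_gt0 nw.
have ww : (r ^+ 2)%:C = w * w^* by rewrite mul_conj nw.
have wc0 : w^* != 0 by rewrite conjc_eq0.
have wz : w - z != 0 by exact: circle_sub_neq0.
rewrite ww /cauchy_kernel -/w; clearbody w.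
rewrite fmorphV rmorphB rmorph1 !(rmorphM Num.conj) fmorphV (rmorphM Num.conj).
rewrite /= !conjCK.
have -> : 1 - z * w^* / (w^* * w) = (w - z) / w by field; rewrite w0 wc0.
by rewrite invfM invrK mulrC.
Qed.

Lemma szego_denom_neq0 (r : R) z w : 0 < r -> normc z < r -> normc w <= r ->
  1 - z^* * w / (r ^+ 2)%:C != 0.
Proof.
move=> r0 zr wr; rewrite subr_eq0; apply/eqP => /(congr1 normc).
rewrite Normc.normc1 Normc.normcM Normc.normcV Normc.normcM normc_conj normc_real.
rewrite ger0_norm ?sqr_ge0 // => e.
suff : normc z * normc w / r ^+ 2 < 1 by rewrite -e ltxx.
rewrite ltr_pdivrMr ?exprn_gt0 // mul1r expr2.
apply: le_lt_trans (_ : normc z * r < _); first by rewrite ler_wpM2l ?normc_ge0.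
by rewrite ltr_pM2r.
Qed.

Lemma derivable_szego (r : R) z w : 0 < r -> normc z < r -> normc w <= r ->
  derivable (fun w : R[i]^o => (1 - z^* * w / (r ^+ 2)%:C)^-1 : R[i]^o) w 1.
Proof.
move=> r0 zr wr; apply: (@derivableV R[i] R[i]^o); first exact: szego_denom_neq0.
apply: (@derivableB R[i] R[i]^o R[i]^o); first exact: derivable_cst.
apply: (@derivableM R[i] R[i]^o); last exact: derivable_cst.
by apply: (@derivableM R[i] R[i]^o); [exact: derivable_cst | exact: derivable_id].
Qed.

(** This is the conjugate of the mean value property for the product of [f]
    with the analytic function of [conj_kernelE].  With [f = 1] it evaluates the
    integral of the kernel itself. *)
Lemma int_conj_kernel f (r : R) z : 0 < r -> normc z < r ->
  (forall w, normc w <= r -> derivable (f : R[i]^o -> R[i]^o) w 1) ->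
  cint 0 (2 * pi) (fun t => (f (r%:C * expi t))^* * cauchy_kernel r z t) =
  (2 * pi)%:C * (f 0)^*.
Proof.
move=> r0 zr df.
pose h (w : R[i]) : R[i] := f w * (1 - z^* * w / (r ^+ 2)%:C)^-1.
have dh w : normc w <= r -> derivable (h : R[i]^o -> R[i]^o) w 1.
  move=> wr; apply: (@derivableM R[i] R[i]^o); first exact: df.
  exact: derivable_szego.
have := mean_value r0 dh; rewrite /h mulr0 mul0r subr0 invr1 mulr1.
move=> /(congr1 Num.conj); rewrite (rmorphM Num.conj) /= conj_real => <-.
rewrite -cint_conj; last by move=> t _; exact: (continuous_circle (ltW r0) dh).
by apply: eq_cint => t _; rewrite conj_kernelE // (rmorphM Num.conj).
Qed.

Lemma cauchy_formula f (r : R) z : 0 < r -> normc z < r ->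
  (forall w, normc w <= r -> derivable (f : R[i]^o -> R[i]^o) w 1) ->
  cint 0 (2 * pi) (fun t => f (r%:C * expi t) * cauchy_kernel r z t) =
  (2 * pi)%:C * f z.
Proof.
move=> r0 zr df; rewrite homotopy_integral // mulrC; congr (_ * _).
have := @int_conj_kernel (fun=> 1) r z r0 zr (fun w _ => derivable_cst _ _ _).
by rewrite rmorph1 mulr1 => <-; apply: eq_cint => t _; rewrite mul1r.
Qed.

End CauchyFormula.

(** * Inner functions are bounded by one *)
Section Boundary.
Context {R : realType}.
Implicit Types (f : R[i] -> R[i]) (z w : R[i]).
Local Notation mu := (@lebesgue_measure R).

Lemma analytic_closed_disk f (r : R) : analytic_on unit_disk f -> r < 1 ->
  forall w, normc w <= r -> derivable (f : R[i]^o -> R[i]^o) w 1.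
Proof. by move=> af r1 w wr; apply: af; apply/unit_diskE; exact: le_lt_trans r1. Qed.

Lemma cauchy_bound f (r : R) z : analytic_on unit_disk f ->
  0 < r -> r < 1 -> normc z < r ->
  normc (f z) * (pi * (r - normc z)) <=
    \int[mu]_(t in `[0, 2 * pi]) normc (f (r%:C * expi t)).
Proof.
move=> af r0 r1 zr; have df := analytic_closed_disk af r1.
have pi0 : 0 < pi :> R by exact: pi_gt0.
have d0 : 0 < r - normc z by rewrite subr_gt0.
have cf := continuous_circle (ltW r0) df.
have cn (t : R) : {for t, continuous (fun t : R => normc (f (r%:C * expi t)))}.
  exact: (continuous_comp (cf t) (@continuous_normc _ _)).
have ck (t : R) : {for t, continuous (cauchy_kernel r z : R -> R[i]^o)}.
  exact: continuous_kernel.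
have ik : continuous_seg 0 (2 * pi) (fun t => f (r%:C * expi t) * cauchy_kernel r z t).
  by move=> t _; apply: (@cvgM R[i]); [exact: cf | exact: ck].
have := @normc_cint_le_int _ 0 (2 * pi) _
  (fun t => r / (r - normc z) * normc (f (r%:C * expi t))) ik.
rewrite cauchy_formula // Normc.normcM normc_real (@gtr0_norm _ (2 * pi)) ?mulr_gt0 //.
have i0 := integrable_seg (fun t (_ : 0 <= t <= 2 * pi) => cn t).
set J := \int[mu]_(t in _) normc _.
have eJ : \int[mu]_(t in `[0, 2 * pi])
    (r / (r - normc z) * normc (f (r%:C * expi t))) = r / (r - normc z) * J.
  by apply: (RintegralZl _ _ i0).
move=> h; have {}h : 2 * pi * normc (f z) <= 2 * (r / (r - normc z) * J).
  rewrite -eJ; apply: h => t _; first by apply: cvgM; [exact: cvg_cst | exact: cn].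
  rewrite Normc.normcM mulrC ler_wpM2r ?normc_ge0 //; exact: normc_kernel_le.
have J0 : 0 <= J by apply: Rintegral_ge0 => t _; exact: normc_ge0.
have {}h : pi * normc (f z) <= r * J / (r - normc z) by lra.
rewrite ler_pdivlMr // in h.
have : r * J <= 1 * J by rewrite ler_wpM2r // ltW.
by move: h; rewrite mul1r => h h'; apply: le_trans h'; rewrite mulrA [_ * pi]mulrC.
Qed.

Lemma boundary_value_seq f z w (u : nat -> R) : boundary_value f z w ->
  (forall n, u n < 1) -> u @ \oo --> (1 : R) ->
  (fun n => normc (f ((u n)%:C * z))) @ \oo --> normc w.
Proof.
move=> bv u1 cu.
have cl : u @ \oo --> (1 : R)^'-.
  move=> P /cu h.
  have {}h : \forall n \near \oo, u n < 1 -> P (u n) by exact: h.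
  by apply: filterS h => n; apply; exact: u1.
have cc : (fun n => f ((u n)%:C * z) : R[i]^o) @ \oo --> (w : R[i]^o).
  exact: (@cvg_comp _ _ _ u (fun r : R => f (r%:C * z) : R[i]^o) _ _ _ cl bv).
exact: (@cvg_comp _ _ _ (fun n => f ((u n)%:C * z) : R[i]^o)
  (@Normc.normc R : R[i]^o -> R) _ _ _ cc (@continuous_normc _ w)).
Qed.

(** By Bernoulli's inequality the powers of a number above 1 are unbounded. *)
Lemma bounded_powers_le1 (x B : R) : 0 <= x -> (forall n, x ^+ n <= B) -> x <= 1.
Proof.
move=> x0 hB; rewrite leNgt; apply/negP => x1.
have [n hn] : exists n : nat, B < x ^+ n.
  exists (Num.bound `|B / (x - 1)|).
  have d0 : 0 < x - 1 by rewrite subr_gt0.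
  set n := Num.bound _.
  have h1 : B / (x - 1) < n%:R.
    by apply: le_lt_trans (ler_norm _) _; by apply: archi_boundP.
  rewrite ltr_pdivrMr // in h1; apply: lt_le_trans h1 _.
  elim: n => [|n ih]; first by rewrite mul0r expr0.
  rewrite exprS -natr1 mulrDl mul1r.
  have : 1 <= x ^+ n by rewrite exprn_ege1 // ltW.
  nra.
by have := hB n; rewrite leNgt hn.
Qed.

Lemma derivable_pow f n z : derivable (f : R[i]^o -> R[i]^o) z 1 ->
  derivable (fun w : R[i]^o => f w ^+ n : R[i]^o) z 1.
Proof.
move=> df; elim: n => [|n ih]; first exact: (@derivable_cst R[i] R[i]^o R[i]^o).
rewrite (_ : (fun w => _) = (fun w => f w * f w ^+ n)); last first.
  by apply/funext => w; rewrite exprS.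
exact: (@derivableM R[i] R[i]^o f (fun w => f w ^+ n) z 1 df ih).
Qed.

(** Boundary values are known almost everywhere only, so the maximum principle
    is replaced by an integral estimate: [cauchy_bound] applied to [f ^+ n] on
    circles whose radii tend to 1 bounds [|f z| ^+ n] by a constant independent
    of [n]. *)
Lemma inner_le1 f z : inner f -> normc z < 1 -> normc (f z) <= 1.
Proof.
move=> [[af [M hM]] bf] z1.
have pi0 : 0 < pi :> R by exact: pi_gt0.
have z0 := normc_ge0 z.
pose rho := 1 - normc z.
have rho0 : 0 < rho by rewrite subr_gt0.
(* Radii tending to 1 that stay away from [normc z]. *)
pose u (k : nat) : R := 1 - rho / 2 * harmonic k.
have hk (k : nat) : 0 < (harmonic k : R) <= 1.
  by rewrite invr_gt0 ltr0n /= invf_le1 ?ltr0n // ler1n.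
have u1 k : u k < 1 by have /andP[h _] := hk k; rewrite /u; nra.
have uz k : normc z + rho / 2 <= u k.
  by have /andP[_ h] := hk k; rewrite /u /rho in rho0 *; nra.
have cu : u @ \oo --> (1 : R).
  rewrite -[X in _ --> X](_ : 1 - rho / 2 * 0 = 1); last by rewrite mulr0 subr0.
  apply: cvgB; first exact: cvg_cst.
  by apply: cvgM; [exact: cvg_cst | exact: cvg_harmonic].
pose B := Re M.
have hB w : normc w < 1 -> normc (f w) <= B.
  by move=> /unit_diskE /hM; rewrite normcR lecE => /andP[_].
apply: (@bounded_powers_le1 _ ((2 * pi) / (pi * (rho / 2)))).
  exact: normc_ge0.
move=> n; rewrite ler_pdivlMr; last by rewrite !mulr_gt0 // divr_gt0.
have afn : analytic_on unit_disk (fun w => f w ^+ n).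
  by move=> w /af; exact: derivable_pow.
pose F (k : nat) (t : R) := (normc (f ((u k)%:C * expi t)) ^+ n)%:E.
have circ k (t : R) : normc ((u k)%:C * expi t) < 1.
  rewrite normc_circle //.
  by have := uz k; rewrite /rho in rho0 *; lra.
have cF k (t : R) : {for t, continuous (fun t : R => normc (f ((u k)%:C * expi t) ^+ n))}.
  have df := analytic_closed_disk afn (u1 k).
  have uk : 0 <= u k by have := uz k; rewrite /rho in rho0 *; lra.
  have := continuous_circle uk df; move=> /(_ t) c.
  exact: (continuous_comp c (@continuous_normc _ _)).
have iF k : mu.-integrable `[0, 2 * pi] (F k).
  have := @integrable_seg _ 0 (2 * pi) _ (fun t _ => cF k t).
  by congr (_.-integrable _ _); apply/funext => t /=; rewrite normcX.
have low k : ((normc (f z) ^+ n * (pi * (rho / 2)))%:E <=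
    \int[mu]_(t in `[0%R, (2 * pi)%R]) F k t)%E.
  have uk : 0 < u k by have := uz k; rewrite /rho in rho0 *; lra.
  have zu : normc z < u k by have := uz k; rewrite /rho in rho0 *; lra.
  rewrite -[leRHS]fineK; last exact: integrable_fin_num.
  rewrite lee_fin; have := cauchy_bound afn uk (u1 k) zu.
  rewrite normcX => h; apply: le_trans (_ : normc (f z) ^+ n * (pi * (u k - normc z)) <= _).
    rewrite ler_wpM2l ?exprn_ge0 ?normc_ge0 // (ler_wpM2l (ltW pi0)) //.
    by have := uz k; lra.
  apply: le_trans h _; rewrite le_eqVlt; apply/orP; left; apply/eqP.
  by congr fine; apply: eq_integral => t _; rewrite /= normcX.
have ae1 : {ae mu, forall t : R, `[0, 2 * pi]%classic t ->
    F ^~ t @ \oo --> (1%:E : \bar R)}.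
  have [N [mN N0 sN]] := bf; exists N; split => // t tN; apply: sN => bt.
  apply: tN => _; case: bt => w bw w1.
  have nw : normc w = 1 by move: w1; rewrite normcR => -[].
  have c := boundary_value_seq bw u1 cu; rewrite nw in c.
  have c2 : (fun k => normc (f ((u k)%:C * expi t)) ^+ n) @ \oo --> (1 : R).
    rewrite -[X in _ --> X](expr1n _ n).
    exact: (cvg_comp _ _ c (@exprn_continuous _ n _)).
  by apply: cvg_EFin c2; apply: nearW.
have ae2 : {ae mu, forall t k, `[0, 2 * pi]%classic t -> (`|F k t| <= (B ^+ n)%:E)%E}.
  apply: aeW => t k _; rewrite /F abse_EFin lee_fin ger0_norm ?exprn_ge0 ?normc_ge0 //.
  by rewrite lerXn2r ?nnegrE ?normc_ge0 ?hB // (le_trans (normc_ge0 _) (hB _ (circ k t))).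
have ig (c : R) : mu.-integrable `[0, 2 * pi] (fun=> c%:E).
  by apply: (@integrable_seg _ 0 (2 * pi) (fun=> c)) => t _; exact: cvg_cst.
have [_ _ cv] := @dominated_convergence _ _ R mu `[0, 2 * pi]%classic
  (measurable_itv _) F (fun=> 1%:E) (fun=> (B ^+ n)%:E)
  (fun k => measurable_int mu (iF k)) (measurable_cst _) ae1 (ig (B ^+ n)) ae2.
have : ((normc (f z) ^+ n * (pi * (rho / 2)))%:E <=
    \int[mu]_(t in `[0%R, (2 * pi)%R]) (1 : R)%:E)%E.
  rewrite -(cvg_lim _ cv) //; apply: lime_ge; first by apply: cvgP cv.
  by apply: nearW => k; exact: low.
rewrite -[leRHS]fineK; last exact: integrable_fin_num (ig 1).
by rewrite lee_fin [leRHS](Rintegral_seg_cst 1) ?mul1r ?subr0 // mulr_ge0 // ltW.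
Qed.

End Boundary.

(** * Schwarz's formula and the maximum principle *)
Section MaximumPrinciple.
Context {R : realType}.
Implicit Types (f u : R[i] -> R[i]) (z w : R[i]).
Local Notation mu := (@lebesgue_measure R).

(** [2 Re k - 1] is the Poisson kernel [(r^2 - |z|^2) / |w - z|^2], bounded
    below as in Harnack's inequality. *)
Lemma Re_kernel_ge (r : R) z (t : R) : 0 < r -> normc z < r ->
  1 + (r - normc z) / (r + normc z) <= 2 * Re (cauchy_kernel r z t).
Proof.
move=> r0 zr; rewrite /cauchy_kernel; set w := r%:C * expi t.
have nw : normc w = r by exact: (normc_circle _ (ltW r0)).
have z0 := normc_ge0 z.
have vle : normc (w - z) <= r + normc z by rewrite -nw; exact: le_normcB.
have v0 : 0 < normc (w - z).
  by rewrite normc_gt0; exact: circle_sub_neq0.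
have e : 2 * Re (w / (w - z)) = 1 + (r ^+ 2 - normc z ^+ 2) / normc (w - z) ^+ 2.
  have n0 : normc (w - z) ^+ 2 != 0 by rewrite gt_eqF // exprn_gt0.
  rewrite -nw; move: n0; rewrite !sqr_normcE; clearbody w.
  case: w z {nw z0 vle v0 zr} => [a b] [c d] /= n0.
  by rewrite /=; field.
rewrite e lerD2l ler_pdivlMr ?exprn_gt0 //.
have s0 : 0 < r + normc z by rewrite ltr_pwDl.
have d0 : 0 < r - normc z by rewrite subr_gt0.
have -> : r ^+ 2 - normc z ^+ 2 = (r - normc z) / (r + normc z) * (r + normc z) ^+ 2.
  by field; rewrite gt_eqF.
by rewrite (ler_wpM2l (ltW (divr_gt0 d0 s0))) // lerXn2r // nnegrE ltW.
Qed.

Lemma Re_cint a b (g : R -> R[i]) :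
  Re (cint a b g) = \int[mu]_(x in `[a, b]) Re (g x).
Proof. by []. Qed.

(** The sum of [cauchy_formula] and [int_conj_kernel]. *)
Lemma schwarz_formula u (r : R) z : analytic_on unit_disk u ->
  0 < r -> r < 1 -> normc z < r ->
  cint 0 (2 * pi) (fun t => (2 * Re (u (r%:C * expi t)))%:C * cauchy_kernel r z t) =
  (2 * pi)%:C * (u z + (u 0)^*).
Proof.
move=> au r0 r1 zr; have du := analytic_closed_disk au r1.
have cu := continuous_circle (ltW r0) du.
have ck (t : R) : {for t, continuous (cauchy_kernel r z : R -> R[i]^o)}.
  exact: continuous_kernel.
have -> : (2 * pi)%:C * (u z + (u 0)^*) =
    cint 0 (2 * pi) (fun t => u (r%:C * expi t) * cauchy_kernel r z t) +
    cint 0 (2 * pi) (fun t => (u (r%:C * expi t))^* * cauchy_kernel r z t).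
  by rewrite (cauchy_formula r0 zr du) (int_conj_kernel r0 zr du) mulrDr.
have c1 : continuous_seg 0 (2 * pi) (fun t => u (r%:C * expi t) * cauchy_kernel r z t).
  by move=> t _; apply: (@cvgM R[i]); [exact: cu | exact: ck].
have c2 : continuous_seg 0 (2 * pi)
    (fun t => (u (r%:C * expi t))^* * cauchy_kernel r z t).
  move=> t _; apply: (@cvgM R[i]); last exact: ck.
  exact: (continuous_comp (cu t) (@continuous_conj _ _)).
rewrite -(cintD c1 c2); apply: eq_cint => t _; rewrite -mulrDl; congr (_ * _).
by apply: eq_ReIm => /=; case: (u _) => a b /=; ring.
Qed.

(** At [z0], the real part of Schwarz's formula says that the nonnegative
    function [Re u] has zero mean against a positive kernel, hence mean zero on
    a circle enclosing [z0] and [z]; Schwarz's formula at [z] then bounds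
    [u z + (u 0)^*] by this mean. *)
Lemma Re_ge0_vanish u z0 : analytic_on unit_disk u ->
  (forall z, normc z < 1 -> 0 <= Re (u z)) ->
  normc z0 < 1 -> Re (u z0) = 0 ->
  forall z, normc z < 1 -> u z = - (u 0)^*.
Proof.
move=> au u0 z01 uz0 z z1.
(* A radius below 1 whose circle encloses both points. *)
pose r := (1 + Num.max (normc z) (normc z0)) / 2.
have [zM z0M] : normc z <= Num.max (normc z) (normc z0) /\
    normc z0 <= Num.max (normc z) (normc z0) by rewrite !le_max !lexx orbT.
have M1 : Num.max (normc z) (normc z0) < 1 by rewrite gt_max z1.
have nz := normc_ge0 z; have nz0 := normc_ge0 z0.
have [r0 r1 zr z0r] : [/\ 0 < r, r < 1, normc z < r & normc z0 < r].
  by rewrite /r; split; lra.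
have du := analytic_closed_disk au r1.
have cu := continuous_circle (ltW r0) du.
have pi0 : 0 < pi :> R by exact: pi_gt0.
have ck x (t : R) : normc x < r -> {for t, continuous (cauchy_kernel r x : R -> R[i]^o)}.
  move=> xr; exact: continuous_kernel.
have cRe (t : R) : {for t, continuous (fun t : R => Re (u (r%:C * expi t)))}.
  exact: (continuous_comp (cu t) (@continuous_Re _ _)).
have Reu t : 0 <= Re (u (r%:C * expi t)).
  by apply: u0; rewrite (normc_circle _ (ltW r0)).
set J := \int[mu]_(t in `[0, 2 * pi]) Re (u (r%:C * expi t)).
have iRe := @integrable_seg _ 0 (2 * pi) _ (fun t _ => cRe t).
have JE : J = 2 * pi * Re (u 0).
  by rewrite /J -Re_cint (mean_value r0 du) Re_mul mul0r subr0.
have J0 : 0 <= J by apply: Rintegral_ge0 => t _; exact: Reu.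
have Jle : J <= 0.
  set c := (r - normc z0) / (r + normc z0).
  have c0 : 0 < c by rewrite divr_gt0 ?subr_gt0 // ltr_pwDl.
  have := schwarz_formula au r0 r1 z0r => /(congr1 Re).
  rewrite Re_cint Re_mul mul0r subr0 raddfD /= uz0 add0r.
  rewrite (_ : Re (u 0)^* = Re (u 0)) -?JE; last by case: (u 0).
  move=> e.
  have : (1 + c) * J <= J.
    rewrite -[leRHS]e /J -(RintegralZl _ _ iRe) //.
    apply: Rintegral_le => t _.
    - by apply: cvgM; [exact: cvg_cst | exact: cRe].
    - have c1 : {for t, continuous (fun t : R => Re (cauchy_kernel r z0 t))}.
        exact: (continuous_comp (ck z0 t z0r) (@continuous_Re _ _)).
      rewrite /prop_for (_ : (fun t => _) = (fun t : R =>
        2 * Re (u (r%:C * expi t)) * Re (cauchy_kernel r z0 t))); last first.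
        by apply/funext => s; rewrite Re_mul mul0r subr0.
      apply: cvgM; last exact: c1.
      by apply: cvgM; [exact: cvg_cst | exact: cRe].
    - rewrite Re_mul mul0r subr0 /= [2 * _]mulrC -mulrA [X in X <= _]mulrC.
      by rewrite ler_wpM2l //; exact: Re_kernel_ge.
  nra.
have {Jle J0}J0 : J = 0 by apply/eqP; rewrite eq_le Jle.
have sch := schwarz_formula au r0 r1 zr.
have : normc ((2 * pi)%:C * (u z + (u 0)^*)) <= 0.
  rewrite -sch.
  pose K := 2 * (r / (r - normc z)).
  suff : normc (cint 0 (2 * pi) (fun t =>
      (2 * Re (u (r%:C * expi t)))%:C * cauchy_kernel r z t)) <= 2 * (K * J).
    by rewrite J0 !mulr0.
  have eJ : \int[mu]_(t in `[0, 2 * pi]) (K * Re (u (r%:C * expi t))) = K * J.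
    exact: (RintegralZl _ _ iRe).
  rewrite -eJ; apply: normc_cint_le_int => t _.
  - apply: (@cvgM R[i]); last exact: ck.
    apply: (@continuous_comp R R R[i]^o (fun t => 2 * Re (u (r%:C * expi t)))
      (real_complex R)); last exact: continuous_real_complex.
    by apply: cvgM; [exact: cvg_cst | exact: cRe].
  - by apply: cvgM; [exact: cvg_cst | exact: cRe].
  - rewrite Normc.normcM normc_real ger0_norm ?mulr_ge0 //.
    have := normc_kernel_le r0 zr t.
    by have := Reu t; rewrite /K; nra.
move=> h; have /Normc.eq0_normc/eqP : normc ((2 * pi)%:C * (u z + (u 0)^*)) = 0.
  by apply/eqP; rewrite eq_le h normc_ge0.
rewrite mulf_eq0 => /orP[|]; last by rewrite addr_eq0 => /eqP.
by rewrite -eq0_normcE normc_real normr_eq0 gt_eqF // mulr_gt0.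
Qed.

(** [1 - (f z0)^* f] has nonnegative real part and vanishes at [z0]. *)
Lemma max_modulus f z0 : analytic_on unit_disk f ->
  (forall z, normc z < 1 -> normc (f z) <= 1) ->
  normc z0 < 1 -> normc (f z0) = 1 -> constant_on_disk f.
Proof.
move=> af f1 z01 fz0; exists (f z0) => z /unit_diskE z1.
pose u z := 1 - (f z0)^* * f z.
have au : analytic_on unit_disk u.
  move=> w /af dw; apply: (@derivableB R[i] R[i]^o R[i]^o); first exact: derivable_cst.
  by apply: (@derivableM R[i] R[i]^o); first exact: derivable_cst.
have u0 w : normc w < 1 -> 0 <= Re (u w).
  move=> /f1 fw; rewrite /u raddfB /= subr_ge0.
  apply: le_trans (ler_norm _) _; apply: le_trans (le_Re_normc _) _.
  by rewrite Normc.normcM normc_conj fz0 mul1r.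
have uz0 : u z0 = 0 by rewrite /u mulrC mul_conj fz0 expr1n subrr.
have h := Re_ge0_vanish au u0 z01 (congr1 Re uz0).
have : u z = 0 by rewrite (h _ z1) -(h _ z01).
move=> /eqP; rewrite subr_eq0 => /eqP e.
by rewrite -[LHS]mul1r [1](_ : _ = f z0 * (f z0)^*) -?mulrA -?e ?mulr1 //
  mul_conj fz0 expr1n.
Qed.

Lemma inner_lt1 f z : inner f -> ~ constant_on_disk f -> normc z < 1 ->
  normc (f z) < 1.
Proof.
move=> fi fc z1; rewrite lt_neqAle inner_le1 // andbT; apply/eqP => e; apply: fc.
by apply: (max_modulus _ _ z1 e); [case: fi => -[] | move=> w; exact: inner_le1].
Qed.

(** The inverse of [f] is inner too, so [f 0] and its inverse have modulus at
    most 1. *)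
Lemma inner_unit_constant f g : inner f -> Hinfty g ->
  (forall z, unit_disk z -> f z * g z = 1) -> constant_on_disk f.
Proof.
move=> fi hg fg.
have gi : inner g.
  split => //; case: fi => _ [N [mN N0 sN]]; exists N; split => // t tN.
  apply: sN => -[w bw w1]; apply: tN.
  exists w^-1; last by rewrite normfV w1 invr1.
  have w0 : w != 0 by rewrite -normr_eq0 w1 oner_eq0.
  have cv : (fun r : R => (f (r%:C * expi t))^-1 : R[i]^o) @ (1 : R)^'- --> (w^-1 : R[i]^o).
    by apply: (@cvgV R[i]).
  apply: cvg_trans cv; apply: near_eq_cvg; near=> r.
  have d : unit_disk (r%:C * expi t).
    apply/unit_diskE; rewrite normc_circle; near: r; first exact: nbhs_left_lt.
    by apply: nbhs_left_ge.
  have f0 : f (r%:C * expi t) != 0.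
    by apply: contra_eqN (fg _ d) => /eqP ->; rewrite mul0r eq_sym oner_eq0.
  by apply: (mulfI f0); rewrite fg // divff.
have d0 : normc (0 : R[i]) < 1 by rewrite Normc.normc0.
have := fg 0; rewrite unit_diskE => /(_ d0) /(congr1 normc).
rewrite Normc.normcM Normc.normc1 => e.
apply: (@max_modulus f 0) => //; first by case: fi => -[].
  by move=> w; exact: inner_le1.
have := inner_le1 fi d0; have := inner_le1 gi d0.
have := normc_ge0 (f 0); have := normc_ge0 (g 0); nra.
Unshelve. all: by end_near. Qed.

End MaximumPrinciple.

(** * Finite Blaschke products of an inner function *)
Section BlaschkeComposition.
Context {R : realType}.
Implicit Types (f g w : R[i] -> R[i]) (z a c : R[i]) (s t : seq R[i]).

Lemma HinftyP f : Hinfty f <-> analytic_on unit_disk f /\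
  exists B : R, forall z, normc z < 1 -> normc (f z) <= B.
Proof.
split=> -[af [B hB]]; split=> //.
  by exists (Re B) => z /unit_diskE /hB; rewrite normcR lecE => /andP[_].
by exists B%:C => z /unit_diskE /hB; rewrite normcR lecR.
Qed.

Lemma Hinfty_cst c : Hinfty (fun=> c).
Proof.
apply/HinftyP; split; last by exists (normc c).
by move=> z _; exact: (@derivable_cst R[i] R[i]^o R[i]^o).
Qed.

Lemma HinftyD f g : Hinfty f -> Hinfty g -> Hinfty (fun z => f z + g z).
Proof.
move=> /HinftyP[af [A hA]] /HinftyP[ag [B hB]]; apply/HinftyP; split.
  move=> z z1; exact: (@derivableD R[i] R[i]^o R[i]^o f g z 1 (af z z1) (ag z z1)).
exists (A + B) => z z1; apply: le_trans (le_normcD _ _) _.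
by rewrite lerD ?hA ?hB.
Qed.

Lemma HinftyM f g : Hinfty f -> Hinfty g -> Hinfty (fun z => f z * g z).
Proof.
move=> /HinftyP[af [A hA]] /HinftyP[ag [B hB]]; apply/HinftyP; split.
  move=> z z1; exact: (@derivableM R[i] R[i]^o f g z 1 (af z z1) (ag z z1)).
exists (A * B) => z z1; rewrite Normc.normcM.
by rewrite ler_pM ?normc_ge0 ?hA ?hB.
Qed.

Lemma Hinfty_horner w (p : {poly R[i]}) : Hinfty w -> Hinfty (fun z => p.[w z]).
Proof.
move=> hw; elim/poly_ind: p => [|p c ih].
  rewrite (_ : (fun z => _) = (fun=> 0)); first exact: Hinfty_cst.
  by apply/funext => z; rewrite horner0.
rewrite (_ : (fun z => _) = (fun z => p.[w z] * w z + c)).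
  by apply: HinftyD; [exact: HinftyM | exact: Hinfty_cst].
by apply/funext => z; rewrite hornerMXaddC.
Qed.

Definition blaschke_factor a z : R[i] := (z - a) / (1 - a^* * z).

Lemma blaschke_denom_ge a z : normc z <= 1 -> 1 - normc a <= normc (1 - a^* * z).
Proof.
move=> z1; rewrite lerBlDr -[leLHS](Normc.normc1 R) -{1}[1%C](subrK (a^* * z)).
apply: le_trans (le_normcD _ _) _; rewrite lerD2l Normc.normcM normc_conj.
by rewrite -[leRHS]mulr1 ler_wpM2l ?normc_ge0.
Qed.

Lemma blaschke_denom_neq0 a z : normc a < 1 -> normc z <= 1 -> 1 - a^* * z != 0.
Proof.
by move=> a1 z1; rewrite -normc_gt0 (lt_le_trans _ (blaschke_denom_ge a z1)) // subr_gt0.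
Qed.

Lemma derivable_blaschke a z : normc a < 1 -> normc z <= 1 ->
  derivable (blaschke_factor a : R[i]^o -> R[i]^o) z 1.
Proof.
move=> a1 z1; apply: (@derivableM R[i] R[i]^o).
  apply: (@derivableB R[i] R[i]^o R[i]^o); last exact: derivable_cst.
  exact: derivable_id.
apply: (@derivableV R[i] R[i]^o); first exact: blaschke_denom_neq0.
apply: (@derivableB R[i] R[i]^o R[i]^o); first exact: derivable_cst.
by apply: (@derivableM R[i] R[i]^o); [exact: derivable_cst | exact: derivable_id].
Qed.

(** On the unit circle the denominator is [z (z - a)^*]. *)
Lemma normc_blaschke_circle a z : normc a < 1 -> normc z = 1 ->
  normc (blaschke_factor a z) = 1.
Proof.
move=> a1 z1; have e : 1 - a^* * z = z * (z - a)^*.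
  by rewrite rmorphB mulrBr mul_conj z1 expr1n mulrC.
rewrite /blaschke_factor e Normc.normcM Normc.normcV Normc.normcM z1 mul1r normc_conj.
rewrite divff // eq0_normcE subr_eq0; apply: contraTneq a1 => <-.
by rewrite z1 ltxx.
Qed.

Section SelfMap.
Variable w : R[i] -> R[i].
Hypothesis inner_w : inner w.
Hypothesis w_disk : forall z, normc z < 1 -> normc (w z) < 1.

Lemma Hinfty_blaschke_comp a : normc a < 1 -> Hinfty (blaschke_factor a \o w).
Proof.
move=> a1; case: inner_w => -[aw _] _; apply/HinftyP; split.
  move=> z z1; apply: derivable_comp; first exact: aw.
  by apply: derivable_blaschke => //; apply/ltW/w_disk/unit_diskE.
exists (2 / (1 - normc a)) => z z1; rewrite Normc.normcM Normc.normcV.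
have wz := ltW (w_disk z1).
apply: ler_pM; rewrite ?invr_ge0 ?normc_ge0 //.
  by apply: le_trans (le_normcB _ _) _; lra.
have h := blaschke_denom_ge a wz.
by rewrite lef_pV2 ?posrE ?subr_gt0 // (lt_le_trans _ h) // subr_gt0.
Qed.

Lemma inner_blaschke_comp a : normc a < 1 -> inner (blaschke_factor a \o w).
Proof.
move=> a1; split; first exact: Hinfty_blaschke_comp.
case: inner_w => _ [N [mN N0 sN]]; exists N; split => // t tN.
apply: sN => -[v bv v1]; apply: tN.
have nv : normc v = 1 by move: v1; rewrite normcR => -[].
exists (blaschke_factor a v); last by rewrite normcR normc_blaschke_circle.
have nv1 : normc v <= 1 by rewrite nv.
have c := derivable_continuous (derivable_blaschke a1 nv1).
exact: (@cvg_comp _ _ _ (fun r : R => w (r%:C * expi t) : R[i]^o)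
  (blaschke_factor a : R[i]^o -> R[i]^o) _ _ _ bv c).
Qed.

(** A Blaschke factor is injective: its value [c] determines [w z] from
    [w z (1 + c a^* ) = a + c], where [1 + c a^* ] cannot vanish as [|a| < 1]. *)
Lemma nonconstant_blaschke_comp a : normc a < 1 -> ~ constant_on_disk w ->
  ~ constant_on_disk (blaschke_factor a \o w).
Proof.
move=> a1 ncw [c hc]; apply: ncw.
have e z : unit_disk z -> w z * (1 + c * a^*) = a + c.
  move=> z1; have := hc z z1; rewrite /= /blaschke_factor.
  have d0 : 1 - a^* * w z != 0.
    by apply: blaschke_denom_neq0 => //; apply/ltW/w_disk/unit_diskE.
  by move=> /(canRL (divfK d0)) h; rewrite mulrDr mulr1 -[w z](subrK a) {1}h subrK; ring.
exists ((a + c) / (1 + c * a^*)) => z z1.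
apply: (canRL (mulfK _)); last exact: e.
apply/eqP => d0.
have := e z z1; rewrite d0 mulr0 => /esym /eqP; rewrite addrC addr_eq0 => /eqP cE.
move: d0; rewrite cE mulNr mul_conj => /eqP; rewrite subr_eq0 => /eqP /(congr1 Re) /=.
by have := normc_ge0 a; nra.
Qed.

Lemma Hinfty_blaschke_prod c s : (forall a, a \in s -> normc a < 1) ->
  Hinfty (fun z => c * \prod_(a <- s) blaschke_factor a (w z)).
Proof.
elim: s => [|a s ih] hs.
  rewrite (_ : (fun z => _) = (fun=> c)); first exact: Hinfty_cst.
  by apply/funext => z; rewrite big_nil mulr1.
rewrite (_ : (fun z => _) = (fun z => (blaschke_factor a \o w) z *
    (c * \prod_(b <- s) blaschke_factor b (w z)))); last first.
  by apply/funext => z; rewrite big_cons mulrCA.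
apply: HinftyM; first by apply: Hinfty_blaschke_comp; exact/hs/mem_head.
by apply: ih => b bs; apply: hs; rewrite inE bs orbT.
Qed.

End SelfMap.

Lemma coprimep_prod_XsubC s t : (forall a, a \in s -> a \notin t) ->
  coprimep (\prod_(a <- s) ('X - a%:P)) (\prod_(a <- t) ('X - a%:P)).
Proof.
elim: s => [|a s ih] st; first by rewrite big_nil coprime1p.
rewrite big_cons coprimepMl ih ?andbT; last first.
  by move=> b bs; apply: st; rewrite inE bs orbT.
by rewrite coprimep_sym coprimep_XsubC root_prod_XsubC st ?mem_head.
Qed.

Definition blaschke_denominator s : {poly R[i]} := \prod_(a <- s) (1 - a^* *: 'X).

Lemma blaschke_prodE s z : (forall a, a \in s -> normc a < 1) -> normc z <= 1 ->
  (\prod_(a <- s) ('X - a%:P)).[z] =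
  (blaschke_denominator s).[z] * \prod_(a <- s) blaschke_factor a z.
Proof.
move=> hs z1; rewrite !horner_prod -big_split /=; apply: eq_big_seq => a /hs a1.
rewrite !hornerE /= /blaschke_factor; field.
exact: blaschke_denom_neq0.
Qed.

(** The converse direction multiplies a Bezout relation between the numerators
    by the denominators, which are polynomials as well: at [w z] it becomes
    [phi z] times a bounded analytic function equals 1. *)
Lemma coprime_blaschke_comp w c d s t : inner w -> ~ constant_on_disk w ->
  c != 0 -> d != 0 ->
  (forall a, a \in s -> normc a < 1) -> (forall a, a \in t -> normc a < 1) ->
  coprime_inner (fun z => c * \prod_(a <- s) blaschke_factor a (w z))
                (fun z => d * \prod_(a <- t) blaschke_factor a (w z)) <->
  (forall a, a \in s -> a \notin t).
Proof.
move=> iw ncw c0 d0 s1 t1.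
have wD z : normc z < 1 -> normc (w z) < 1 by exact: inner_lt1.
split=> [cop a sa|disj phi [iphi [psi hpsi e1]] [_ [psi' hpsi' e2]]].
  apply/negP => ta.
  have div u (r : seq R[i]) : a \in r -> (forall b, b \in r -> normc b < 1) ->
      inner_divisor (blaschke_factor a \o w)
        (fun z => u * \prod_(b <- r) blaschke_factor b (w z)).
    move=> ar r1; split; first exact: (inner_blaschke_comp iw wD (r1 _ ar)).
    exists (fun z => u * \prod_(b <- rem a r) blaschke_factor b (w z)).
      by apply: (Hinfty_blaschke_prod iw wD) => b /mem_rem; exact: r1.
    by move=> z _; rewrite (big_rem _ ar) /= mulrCA.
  apply: (nonconstant_blaschke_comp wD (s1 _ sa) ncw).
  by apply: cop; apply: div.
have /Bezout_coprimepP[[u v] /= /eqpP[[k l] /= /andP[k0 l0] bez]] :=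
  coprimep_prod_XsubC disj.
have hw : Hinfty w by case: iw.
apply: (@inner_unit_constant _ phi (fun z => k / l *
  ((u * blaschke_denominator s).[w z] * (c^-1 * psi z) +
   (v * blaschke_denominator t).[w z] * (d^-1 * psi' z)))) => //.
  apply: HinftyM; first exact: Hinfty_cst.
  apply: HinftyD; apply: HinftyM; [exact: Hinfty_horner| |exact: Hinfty_horner|];
    by apply: HinftyM => //; exact: Hinfty_cst.
move=> z zD; have z1 : normc (w z) <= 1 by apply/ltW/wD/unit_diskE.
have /= e := congr1 (horner^~ (w z)) bez.
rewrite !hornerZ hornerD !hornerM hornerC mulr1 !blaschke_prodE // in e.
have E1 : \prod_(a <- s) blaschke_factor a (w z) = c^-1 * (phi z * psi z).
  by rewrite -e1 // mulKf.
have E2 : \prod_(a <- t) blaschke_factor a (w z) = d^-1 * (phi z * psi' z).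
  by rewrite -e2 // mulKf.
rewrite E1 E2 in e; rewrite !hornerM; apply: (mulfI l0); rewrite mulr1 -[RHS]e.
by field; rewrite c0 d0 l0.
Qed.

Lemma coprime_inner_ext f f' g g' :
  (forall z, unit_disk z -> f z = f' z) -> (forall z, unit_disk z -> g z = g' z) ->
  coprime_inner f g <-> coprime_inner f' g'.
Proof.
have aux h h' phi : (forall z, unit_disk z -> h z = h' z) ->
    inner_divisor phi h -> inner_divisor phi h'.
  by move=> hh [ip [psi hp e]]; split=> //; exists psi => // z zD; rewrite -hh ?e.
move=> ff gg; split=> cop phi d1 d2; apply: cop.
- by apply: aux d1 => z /ff.
- by apply: aux d2 => z /gg.
- exact: aux d1.
- exact: aux d2.
Qed.

Lemma inner_id : inner (@id R[i]).
Proof.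
split.
  apply/HinftyP; split; last by exists 1 => z /ltW.
  by move=> z _; exact: (@derivable_id R[i] R[i]^o).
exists set0; split; rewrite ?measure0 // => t; apply; exists (expi t).
  rewrite /boundary_value -{2}[expi t]mul1r.
  apply: (@cvgM R[i]); last exact: cvg_cst.
  by apply: cvg_at_left_filter; exact: continuous_real_complex.
by rewrite normcR normc_expi.
Qed.

Lemma nonconstant_id : ~ constant_on_disk (@id R[i]).
Proof.
move=> [c hc].
have h0 := hc 0; rewrite unit_diskE Normc.normc0 in h0.
have h1 := hc (2^-1)%:C; rewrite unit_diskE normc_real in h1.
have : `|2^-1| < 1 :> R by rewrite ger0_norm; lra.
move=> /h1; rewrite -(h0 ltr01) => /(congr1 Re) /=; lra.
Qed.

End BlaschkeComposition.

Unset Implicit Arguments.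

Theorem theorem4p25 (R : realType) (theta delta omega : R[i] -> R[i])
  (htheta : finite_blaschke theta) (hdelta : finite_blaschke delta)
  (homega : inner omega) (homega_nonconst : ~ constant_on_disk omega)
  (hcases : finite_blaschke omega \/
    zeros theta `|` zeros delta `<=`
      \bigcup_(z0 in singularities omega) range_set omega z0) :
  coprime_inner theta delta <->
  coprime_inner (theta \o omega) (delta \o omega).
Proof.
have [c [s [c1 s1 es]]] := htheta; have [d [t [d1 t1 et]]] := hdelta.
have c0 : c != 0 by rewrite -normr_eq0 c1 oner_eq0.
have d0 : d != 0 by rewrite -normr_eq0 d1 oner_eq0.
have {}s1 a : a \in s -> normc a < 1 by move=> /s1 /unit_diskE.
have {}t1 a : a \in t -> normc a < 1 by move=> /t1 /unit_diskE.
have wD z : unit_disk z -> unit_disk (omega z).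
  by move=> /unit_diskE z1; apply/unit_diskE; exact: inner_lt1.
apply: iff_trans (coprime_inner_ext es et) _.
apply: iff_trans (coprime_blaschke_comp (@inner_id R) (@nonconstant_id R) c0 d0 s1 t1) _.
apply: iff_sym.
apply: iff_trans (coprime_blaschke_comp homega homega_nonconst c0 d0 s1 t1).
by apply: coprime_inner_ext => z /wD zD /=; [exact: es | exact: et].
Qed.
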